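(* Let $f$ satisfy Hypothesis 1 or Hypothesis 2 (see context), let $\eta\in(0,1]$, $\theta\in(1-\alpha,+\infty)$, and let $(\rho_1,\rho_2)$ be a classical solution of the viscous system (see context) with $\rho_{1,0},\rho_{2,0}\in\mathscr{P}(\Omega)$ and $\sigma_0^{-\theta}\in L^1(\Omega)$, where $\sigma_0=\rho_{1,0}+\rho_{2,0}$ and $\sigma=\rho_1+\rho_2$. Then there exists $\mathcal{K}_{2,\theta}>0$, depending only on $\alpha,\kappa,\theta,|\Omega|,T$, $\|\sigma_0^{-\theta}\|_{L^1(\Omega)}$ and the Lipschitz constants of $V_1,V_2$ (in particular independent of $\eta$), such that \[ \|\sigma^{-\theta}\|_{L^\infty([0,T];L^1(\Omega))}+\big\|\partial_x\sigma^{\frac{\alpha-1-\theta}{2}}\big\|_{L^2([0,T]\times\Omega)}<\mathcal{K}_{2,\theta}. \]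
   Context: $\Omega=(0,L)$, $T>0$. Hypothesis 1: (H1) $f(s)=\frac{\lambda}{\alpha-1}s^\alpha$ with $\alpha\in(0,1)$, $\lambda>0$; or (H2) $f(s)=\lambda s\log s$, $\lambda>0$. Hypothesis 2: (I1) $f\in C^{4,\beta}_{loc}(0,\infty)$ for some $\beta\in(0,1]$, $f''>0$; (I2) $\frac{1}{\alpha\kappa}s^\alpha\le s^2f''(s)$ for $s>0$, with $\alpha\in(0,1)$, $\kappa>0$; (I3) $|sf'''(s)/f''(s)|\le\kappa$; (I4) $\int_\Omega f(\mu)\,dx>-\mathcal{K}_{\inf}$ for all $\mu\in\mathscr{P}^{ac}(\Omega)$. When $f$ is as in Hypothesis 1, $\alpha,\kappa$ denote the corresponding constants determined by $f$. Viscous system, for $\eta\in(0,1]$, $i\in\{1,2\}$: $\partial_t\rho_i=\eta\partial_{xx}\rho_i+\partial_x(\rho_i\partial_x(f'(\rho_1+\rho_2)+V_i))$ in $(0,T)\times\Omega$, $\rho_i(0)=\rho_{i,0}$, $\eta\partial_x\rho_i+\rho_i\partial_x(f'(\rho_1+\rho_2)+V_i)=0$ on $(0,T)\times\partial\Omega$. Standing assumptions: $V_1,V_2\in C^{3,1}(\overline\Omega)$ with $\partial_xV_1=\partial_xV_2=0$ on $\partial\Omega$; $\rho_{i,0}\in C^{3,1}(\overline\Omega)$ probability densities with $\rho_{1,0}+\rho_{2,0}>0$ on $\overline\Omega$ satisfying the zeroth- and first-order boundary compatibility conditions; $f\in C^{4,\beta}_{loc}(0,\infty)$, $f''\ge0$.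 A classical solution is a pair $\rho_1,\rho_2\in C([0,T];C^3(\overline\Omega))\cap C^1([0,T];C^1(\overline\Omega))$ satisfying the system pointwise, with $\rho_1+\rho_2>0$. *)

(* Defs.v *)
From HB Require Import structures.
From mathcomp Require Import all_boot all_order all_algebra.
From mathcomp Require Import all_classical all_reals all_analysis.
Set Implicit Arguments. Unset Strict Implicit. Unset Printing Implicit Defensive.
Import Order.TTheory GRing.Theory Num.Theory.
Import numFieldNormedType.Exports.
Local Open Scope classical_set_scope.
Local Open Scope ring_scope.

Notation Leb := (@lebesgue_measure _).

Section Defs.
Variable R : realType.

Definition dq_filter (A : set R) (x : R) : set_system R :=
  within (fun h : R => h != 0 /\ A (x + h)) (nbhs (0 : R)).

Definition dquot (f : R -> R) (x : R) : R -> R := fun h => h^-1 * (f (x + h) - f x).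

(* f is differentiable at x relative to the set A (one-sided at endpoints) *)
Definition derivable_within (A : set R) (f : R -> R) (x : R) : Prop :=
  exists d : R, dquot f x @ dq_filter A x --> d.

(* the derivative of f relative to A (classical derivative at interior points) *)
Definition dw (A : set R) (f : R -> R) (x : R) : R := lim (dquot f x @ dq_filter A x).

Definition iterd (j : nat) (A : set R) (f : R -> R) : R -> R := iter j (dw A) f.

Definition Ck_on (k : nat) (A : set R) (f : R -> R) : Prop :=
  (forall j, (j < k)%N -> forall x, A x -> derivable_within A (iterd j A f) x) /\
  (forall j, (j <= k)%N -> {within A, continuous (iterd j A f)}).

Definition Pos : set R := [set` `]0, +oo[%classic].
Definition Icl (L : R) : set R := [set` `[0, L]%classic].
Definition Jcl (T : R) : set R := [set` `[0, T]%classic].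
Definition Jop (T : R) : set R := [set` `]0, T[%classic].
Definition Iop (L : R) : set R := [set` `]0, L[%classic].

Definition C31 (L : R) (g : R -> R) : Prop :=
  Ck_on 3 (Icl L) g /\
  exists C : R, forall x y, Icl L x -> Icl L y ->
    `|iterd 3 (Icl L) g x - iterd 3 (Icl L) g y| <= C * `|x - y|.

Definition C4beta_loc (beta : R) (f : R -> R) : Prop :=
  Ck_on 4 Pos f /\
  forall a b, 0 < a -> a < b -> exists C : R, forall x y, x \in `[a, b] -> y \in `[a, b] ->
    `|iterd 4 Pos f x - iterd 4 Pos f y| <= C * (`|x - y| `^ beta).

Definition fd (j : nat) (f : R -> R) : R -> R := iterd j Pos f.

Definition lip_on (A : set R) (C : R) (g : R -> R) : Prop :=
  forall x y, A x -> A y -> `|g x - g y| <= C * `|x - y|.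



Definition prob_density (L : R) (mu : R -> R) : Prop :=
  measurable_fun (Iop L) mu /\ (forall x, Iop L x -> 0 <= mu x) /\
  Leb.-integrable (Iop L) (fun x => (mu x)%:E) /\ Rintegral Leb (Iop L) mu = 1.

(* Hypothesis 1 (H1) with exponent alpha; kappa is a constant for which the
   structural inequalities (I2),(I3) hold for this f. *)
Definition I2 (alpha kappa : R) (f : R -> R) : Prop :=
  forall s, 0 < s -> (alpha * kappa)^-1 * s `^ alpha <= s ^+ 2 * fd 2 f s.
Definition I3 (kappa : R) (f : R -> R) : Prop :=
  forall s, 0 < s -> `|s * fd 3 f s / fd 2 f s| <= kappa.

Definition hypH1 (alpha kappa : R) (f : R -> R) : Prop :=
  (0 < alpha < 1) /\ 0 < kappa /\
  (exists lam : R, 0 < lam /\ forall s, 0 < s -> f s = lam / (alpha - 1) * s `^ alpha) /\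
  I2 alpha kappa f /\ I3 kappa f.

Definition hypH2 (alpha kappa : R) (f : R -> R) : Prop :=
  alpha = 1 /\ 0 < kappa /\
  (exists lam : R, 0 < lam /\ forall s, 0 < s -> f s = lam * (s * ln s)) /\
  I2 alpha kappa f /\ I3 kappa f.

Definition hyp2 (L alpha kappa : R) (f : R -> R) : Prop :=
  (0 < alpha < 1) /\ 0 < kappa /\
  (exists beta : R, 0 < beta <= 1 /\ C4beta_loc beta f) /\
  (forall s, 0 < s -> 0 < fd 2 f s) /\
  I2 alpha kappa f /\ I3 kappa f /\
  (exists Kinf : R, forall mu, prob_density L mu ->
     (\int[Leb]_(x in Iop L) (f (mu x))%:E > (- Kinf)%:E)%E).

Definition hyp_f (L alpha kappa : R) (f : R -> R) : Prop :=
  hypH1 alpha kappa f \/ hypH2 alpha kappa f \/ hyp2 L alpha kappa f.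

Definition flux (L eta : R) (f V ri s : R -> R) : R -> R :=
  fun y => eta * dw (Icl L) ri y + ri y * dw (Icl L) (fun z => fd 1 f (s z) + V z) y.

Definition Aop (L eta : R) (f V ri s : R -> R) : R -> R := dw (Icl L) (flux L eta f V ri s).

(* time derivative of the flux at t = 0, with d_t rho_j = w_j *)
Definition lin_flux (L eta : R) (f V ri s wi w : R -> R) : R -> R :=
  fun y => eta * dw (Icl L) wi y + wi y * dw (Icl L) (fun z => fd 1 f (s z) + V z) y
           + ri y * dw (Icl L) (fun z => fd 2 f (s z) * w z) y.

Definition box (L T : R) : set (R * R) := [set p | Jcl T p.1 /\ Icl L p.2].

Definition dt (T : R) (r : R -> R -> R) : R -> R -> R :=
  fun t x => dw (Jcl T) (fun s => r s x) t.

(* r in C([0,T]; C^3(closure Omega)) cap C^1([0,T]; C^1(closure Omega)),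
   written pointwise *)
Definition sol_regular (L T : R) (r : R -> R -> R) : Prop :=
  (forall t, Jcl T t -> forall j, (j < 3)%N -> forall x, Icl L x ->
      derivable_within (Icl L) (iterd j (Icl L) (r t)) x) /\
  (forall j, (j <= 3)%N ->
      {within box L T, continuous (fun p : R * R => iterd j (Icl L) (r p.1) p.2)}) /\
  (forall t x, Jcl T t -> Icl L x -> derivable_within (Jcl T) (fun s => r s x) t) /\
  (forall t x, Jcl T t -> Icl L x -> derivable_within (Icl L) (dt T r t) x) /\
  {within box L T, continuous (fun p : R * R => dt T r p.1 p.2)} /\
  {within box L T, continuous (fun p : R * R => dw (Icl L) (dt T r p.1) p.2)}.

Definition classical_solution (L T eta : R) (f V1 V2 r10 r20 : R -> R) (r1 r2 : R -> R -> R) : Prop :=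
  let sig := fun t x => r1 t x + r2 t x in
  sol_regular L T r1 /\ sol_regular L T r2 /\
  (forall t x, Jcl T t -> Icl L x -> 0 < sig t x) /\
  (forall x, Icl L x -> r1 0 x = r10 x /\ r2 0 x = r20 x) /\
  (forall t x, Jop T t -> Iop L x ->
     dt T r1 t x = Aop L eta f V1 (r1 t) (sig t) x /\
     dt T r2 t x = Aop L eta f V2 (r2 t) (sig t) x) /\
  (forall t, Jop T t ->
     flux L eta f V1 (r1 t) (sig t) 0 = 0 /\ flux L eta f V1 (r1 t) (sig t) L = 0 /\
     flux L eta f V2 (r2 t) (sig t) 0 = 0 /\ flux L eta f V2 (r2 t) (sig t) L = 0).

Definition standing (L eta : R) (f V1 V2 r10 r20 : R -> R) : Prop :=
  let s0 := fun x => r10 x + r20 x in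
  let w1 := Aop L eta f V1 r10 s0 in
  let w2 := Aop L eta f V2 r20 s0 in
  let w := fun x => w1 x + w2 x in
  C31 L V1 /\ C31 L V2 /\
  dw (Icl L) V1 0 = 0 /\ dw (Icl L) V1 L = 0 /\
  dw (Icl L) V2 0 = 0 /\ dw (Icl L) V2 L = 0 /\
  C31 L r10 /\ C31 L r20 /\
  (forall x, Icl L x -> 0 <= r10 x /\ 0 <= r20 x) /\
  Rintegral Leb (Iop L) r10 = 1 /\ Rintegral Leb (Iop L) r20 = 1 /\
  (forall x, Icl L x -> 0 < s0 x) /\
  flux L eta f V1 r10 s0 0 = 0 /\ flux L eta f V1 r10 s0 L = 0 /\
  flux L eta f V2 r20 s0 0 = 0 /\ flux L eta f V2 r20 s0 L = 0 /\
  lin_flux L eta f V1 r10 s0 w1 w 0 = 0 /\ lin_flux L eta f V1 r10 s0 w1 w L = 0 /\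
  lin_flux L eta f V2 r20 s0 w2 w 0 = 0 /\ lin_flux L eta f V2 r20 s0 w2 w L = 0 /\
  (exists beta : R, 0 < beta <= 1 /\ C4beta_loc beta f) /\
  (forall s, 0 < s -> 0 <= fd 2 f s).

End Defs.

(* Main.v *)
Require Import Defs.
From HB Require Import structures.
From mathcomp Require Import all_boot all_order all_algebra.
From mathcomp Require Import all_classical all_reals all_analysis.
From mathcomp Require Import ring lra.
Import Order.TTheory GRing.Theory Num.Theory.
Import numFieldNormedType.Exports.
Local Open Scope classical_set_scope.
Local Open Scope ring_scope.
Set Implicit Arguments. Unset Strict Implicit. Unset Printing Implicit Defensive.

(** A classical solution satisfies [u_t = F_x] with [F = 0] at both ends, so
    [d/dt int Phi(u) = - int Phi''(u) u_x F] for every [Phi] of class C^2.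

    With [Phi(s) = (s^-)^3] and [F = eta u_x + u b], [b] bounded on the space-time
    box, Young's inequality and Gronwall's lemma give [u = rho_i >= 0]; hence
    [|rho_1 V_1' + rho_2 V_2'| <= lam * sigma].

    With [Phi(s) = s^(-theta)] and [u = sigma], (I2) bounds the diffusive part of
    [Phi''(u) u_x F] below by a multiple of [|d_x sigma^((alpha-1-theta)/2)|^2].
    Young's inequality absorbs the drift up to a multiple of
    [sigma^(1-alpha-theta) <= 1 + sigma^(-theta)], and Gronwall's lemma applied to
    [int sigma^(-theta) + c int_0^t int |d_x sigma^((alpha-1-theta)/2)|^2 + L]
    bounds both terms of the claim independently of [eta]. *)

(** * Derivatives relative to a set *)

Section DerivativeWithin.
Variable R : realType.
Implicit Types (A : set R) (f g : R -> R) (x d : R).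

(** Relational form of [dw]: the value [lim] means something only where the limit exists and is
    unique, whereas this relation passes through sums, products and compositions with no such side
    condition. *)
Definition has_dw A f x d := dquot f x @ dq_filter A x --> d.

Lemma dq_filterE A x (P : set R) :
  (\forall h \near (0 : R), h != 0 -> A (x + h) -> P h) -> dq_filter A x P.
Proof.
by apply: filterS => h H [h0 Ah]; exact: H. Qed.

#[global] Instance dq_filter_filter A x : Filter (dq_filter A x).
Proof. exact: within_filter. Qed.

Lemma dq_filter_proper_nbhs A x : nbhs x A -> ProperFilter (dq_filter A x).
Proof.
move=> nA; apply: Build_ProperFilter_ex => P /= nP.
have : \forall h \near (0 : R), A (x + h).
  have : (x + h) @[h --> (0 : R)] --> x.
    by rewrite -[X in _ --> X]addr0; apply: cvgD; [exact: cvg_cst|exact: cvg_id].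
  by apply.
move: nP; rewrite /dq_filter /within => nP nA'.
have /nbhs_ballP[e /= e0 He] : nbhs (0 : R) [set h | (h != 0 /\ A (x + h) -> P h) /\ A (x + h)].
  exact: (@filterI _ (nbhs (0 : R)) _ _ _ nP nA').
have [|H1 H2] := He (e / 2).
  by rewrite /ball /= sub0r normrN gtr0_norm ?divr_gt0// ltr_pdivrMr// ltr_pMr// ltr1n.
by exists (e / 2); apply: H1; split => //; rewrite gt_eqF// divr_gt0.
Qed.

(** Properness, endpoints included, makes one-sided limits unique and so ties [has_dw] to [dw].
    Admissible increments of any small size exist: to the right if [x < b], to the left at [b]. *)
Lemma dq_filter_proper_itv (a b x : R) : a < b -> x \in `[a, b] ->
  ProperFilter (dq_filter `[a, b] x).
Proof.
move=> ab; rewrite in_itv /= => /andP[ax xb]; apply: Build_ProperFilter_ex => P.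
rewrite /dq_filter /within /= => /nbhs_ballP[e /= e0 He].
have [xb'|xb'] := ltP x b.
  pose h := Num.min (e / 2) (b - x).
  have h0 : 0 < h by rewrite lt_min divr_gt0//= subr_gt0.
  exists h; apply: He.
    rewrite /ball /= sub0r normrN gtr0_norm// gt_min ltr_pdivrMr//.
    by rewrite ltr_pMr// ltr1n.
  split; first by rewrite gt_eqF.
  rewrite /= in_itv/= (le_trans ax) ?lerDl ?(ltW h0)//=.
  by rewrite -lerBrDl ge_min lexx orbT.
pose h := Num.min (e / 2) (x - a).
have h0 : 0 < h by rewrite lt_min divr_gt0//= subr_gt0 (lt_le_trans ab).
exists (- h); apply: He.
  rewrite /ball /= sub0r normrN normrN gtr0_norm// gt_min ltr_pdivrMr//.
  by rewrite ltr_pMr// ltr1n.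
split; first by rewrite oppr_eq0 gt_eqF.
rewrite /= in_itv/=; apply/andP; split; last first.
  by rewrite (le_trans _ xb)// gerBl ltW.
by rewrite lerBrDr addrC -lerBrDr ge_min lexx orbT.
Qed.

Lemma has_dw_dw A f x d : ProperFilter (dq_filter A x) ->
  has_dw A f x d -> dw A f x = d.
Proof. by move=> PF fd; apply/cvg_lim. Qed.

Lemma derivable_withinP A f x : ProperFilter (dq_filter A x) ->
  derivable_within A f x -> has_dw A f x (dw A f x).
Proof. by move=> PF [d fd]; rewrite (has_dw_dw PF fd). Qed.

Lemma dq_eq_cvg A x (F G : R -> R) d :
  (forall h, h != 0 -> A (x + h) -> F h = G h) ->
  F @ dq_filter A x --> d -> G @ dq_filter A x --> d.
Proof.
move=> FG; apply: cvg_trans; apply: near_eq_cvg.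
have : dq_filter A x [set h | F h = G h].
  by apply: dq_filterE; apply: filterE => h h0 Ah; rewrite /= FG.
by [].
Qed.

Lemma has_dw_eq A f g x d : A x -> (forall y, A y -> f y = g y) ->
  has_dw A f x d -> has_dw A g x d.
Proof.
by move=> Ax fg; apply: dq_eq_cvg => h _ Ah; rewrite /dquot !fg.
Qed.

Lemma has_dw_cst A x (c : R) : has_dw A (fun=> c) x 0.
Proof.
rewrite /has_dw (_ : dquot _ _ = fun=> 0); first exact: cvg_cst.
by apply/funext => h; rewrite /dquot subrr mulr0.
Qed.

Lemma has_dwD A f g x d e : has_dw A f x d -> has_dw A g x e ->
  has_dw A (fun y => f y + g y) x (d + e).
Proof.
move=> fd gd; rewrite /has_dw (_ : dquot _ _ = dquot f x \+ dquot g x).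
  exact: cvgD.
by apply/funext => h; rewrite /dquot /=; ring.
Qed.

(** Differentiability implies continuity: the increment of [f] is [h] times the difference
    quotient. *)
Lemma has_dw_cvg_shift A f x d : has_dw A f x d ->
  f (x + h) @[h --> dq_filter A x] --> f x.
Proof.
move=> fd; have h0 : h @[h --> dq_filter A x] --> (0 : R).
  apply: (@cvg_trans _ (nbhs (0 : R))); last exact: cvg_id.
  by move=> P P0; apply: dq_filterE; apply: filterS P0.
have : (h * dquot f x h + f x) @[h --> dq_filter A x] --> 0 * d + f x.
  by apply: cvgD; [exact: cvgM|exact: cvg_cst].
rewrite mul0r add0r; apply: dq_eq_cvg => h hn0 _.
by rewrite /dquot mulVKf// subrK.
Qed.

Lemma has_dwM A f g x d e : has_dw A f x d -> has_dw A g x e ->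
  has_dw A (fun y => f y * g y) x (d * g x + f x * e).
Proof.
move=> fd gd; rewrite /has_dw
  (_ : dquot _ _ = fun h => dquot f x h * g (x + h) + f x * dquot g x h).
  apply: cvgD; first by apply: cvgM => //; exact: has_dw_cvg_shift gd.
  by apply: cvgM => //; exact: cvg_cst.
by apply/funext => h; rewrite /dquot /=; ring.
Qed.

Lemma has_dwZ A f x d (c : R) : has_dw A f x d ->
  has_dw A (fun y => c * f y) x (c * d).
Proof.
move=> fd; rewrite -[c * d]add0r -[0 in X in _ _ _ X](mul0r (f x)).
exact: has_dwM (has_dw_cst _ _ _) fd.
Qed.

(** Carathéodory's slope function [p] of [g] at [f x] replaces a division by [f (x + h) - f x],
    which may vanish. *)
Lemma has_dw_comp A f g x d e : is_derive (f x) 1 g e -> has_dw A f x d ->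
  has_dw A (fun y => g (f y)) x (e * d).
Proof.
move=> /is_derive1_caratheodory[p [pE pc <-]] fd.
rewrite /has_dw (_ : dquot _ _ = fun h => p (f (x + h)) * dquot f x h).
  apply: cvgM => //.
  apply: (@cvg_comp _ _ _ (fun h => f (x + h)) p _ (nbhs (f x))) => //.
  exact: has_dw_cvg_shift fd.
by apply/funext => h; rewrite /dquot pE; ring.
Qed.

(** At an interior point the constraint [A (x + h)] holds for all small [h], so the relative limit
    is the two-sided one. *)
Lemma has_dw_is_derive A f x d : nbhs x A -> has_dw A f x d -> is_derive x 1 f d.
Proof.
move=> nA fd.
have cv0 : dquot f x @ 0^' --> d.
  apply: cvg_trans fd; apply: cvg_app => P nP.
  have xh : (x + h) @[h --> (0 : R)] --> x.
    by rewrite -[X in _ --> X]addr0; apply: cvgD; [exact: cvg_cst|exact: cvg_id].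
  have nA' : nbhs (0 : R) [set h | A (x + h)] by exact: xh.
  have : nbhs (0 : R) [set h | (h != 0 /\ A (x + h) -> P h) /\ A (x + h)].
    exact: (@filterI _ (nbhs (0 : R)) _ _ _ nP nA').
  by apply: filterS => h [H Ah] h0; exact: H.
have cv : h^-1 *: (f (h *: 1 + x) - f x) @[h --> 0^'] --> d.
  rewrite (_ : (fun h => _) = dquot f x)//; apply/funext => h.
  by rewrite /dquot /GRing.scale /= mulr1 (addrC h).
apply: DeriveDef; last exact/cvg_lim.
by apply/cvg_ex; exists d.
Qed.

End DerivativeWithin.

(** * Integrals over an interval *)

Section IntegralToolbox.
Variable R : realType.

Lemma IclE (L : R) : Icl L = `[0, L]%classic.
Proof. by apply/seteqP; split=> x; rewrite /Icl/= inE. Qed.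
Lemma IopE (L : R) : Iop L = `]0, L[%classic.
Proof. by apply/seteqP; split=> x; rewrite /Iop/= inE. Qed.
Lemma PosE : @Pos R = `]0, +oo[%classic.
Proof. by apply/seteqP; split=> x; rewrite /Pos/= inE. Qed.
Lemma IclP (L x : R) : Icl L x <-> 0 <= x <= L.
Proof. by rewrite IclE /= in_itv. Qed.
Lemma IopP (L x : R) : Iop L x <-> 0 < x < L.
Proof. by rewrite IopE /= in_itv. Qed.
Lemma PosP (x : R) : Pos x <-> 0 < x.
Proof. by rewrite PosE /= in_itv /= andbT. Qed.

Lemma Iop_Icl (L x : R) : Iop L x -> Icl L x.
Proof. by rewrite IopP IclP => /andP[/ltW -> /ltW ->]. Qed.

Lemma Icl_nbhs (L x : R) : Iop L x -> nbhs x (Icl L).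
Proof.
rewrite IopE => xI; have : nbhs x `]0, L[%classic.
  by apply: open_nbhs_nbhs; split => //; exact: interval_open.
by apply: filterS => y; rewrite -IopE; exact: Iop_Icl.
Qed.

Lemma Pos_nbhs (x : R) : 0 < x -> nbhs x (@Pos R).
Proof.
move=> x0; rewrite PosE; apply: open_nbhs_nbhs; split => //=.
by rewrite in_itv /= x0.
Qed.

Lemma Icl_proper (L x : R) : 0 < L -> Icl L x -> ProperFilter (dq_filter (Icl L) x).
Proof. by move=> L0; rewrite IclE => xI; exact: dq_filter_proper_itv. Qed.

Lemma Icl_has_dw (L x : R) f : 0 < L -> Icl L x -> derivable_within (Icl L) f x ->
  has_dw (Icl L) f x (dw (Icl L) f x).
Proof. by move=> L0 Ix; apply: derivable_withinP; exact: Icl_proper. Qed.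

Lemma Icl_dwE (L x : R) f d : 0 < L -> Icl L x -> has_dw (Icl L) f x d ->
  dw (Icl L) f x = d.
Proof. by move=> L0 Ix; apply: has_dw_dw; exact: Icl_proper. Qed.

Lemma Icl_compact (L : R) : compact (Icl L).
Proof. by rewrite IclE; exact: segment_compact. Qed.

Lemma measurable_Icl (L : R) : measurable (Icl L : set (measurableTypeR R)).
Proof. by rewrite IclE. Qed.

Lemma Icl_integrable (L : R) g : {within Icl L, continuous g} ->
  Leb.-integrable (Icl L) (EFin \o g).
Proof. by move=> cg; apply: continuous_compact_integrable => //; exact: Icl_compact. Qed.

Lemma Rintegral_Iop (L : R) g : {within Icl L, continuous g} ->
  Rintegral Leb (Iop L) g = Rintegral Leb (Icl L) g.
Proof.
move=> cg; have ig := Icl_integrable cg.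
rewrite IopE IclE in ig *; rewrite Rintegral_itv_obnd_cbnd; last first.
  by apply: integrableS ig => //; exact: subset_itvW.
rewrite Rintegral_itv_bndo_bndc//; apply: integrableS ig => //.
by move=> x /=; rewrite !in_itv /= => /andP[-> /ltW ->].
Qed.

(** For [0 < T] this is the retraction of the line onto the interval from 0 to [T]; composing with
    it extends a function continuous on the closed interval to a continuous function on the line. *)
Definition clamp (T t : R) : R := Num.max 0 (Num.min t T).

Lemma clamp_id T t : Icl T t -> clamp T t = t.
Proof.
rewrite IclP /clamp => /andP[t0 tT].
by rewrite min_l// max_r.
Qed.

Lemma clamp_in T t : 0 < T -> Icl T (clamp T t).
Proof.
move=> T0; rewrite IclP /clamp le_max lexx /= ge_max (ltW T0) /=.
by rewrite ge_min lexx orbT.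
Qed.

Lemma clamp_continuous T : continuous (clamp T).
Proof.
move=> t; apply: (@continuous_max R R (fun=> 0) (id \min (fun=> T)) t).
  exact: cst_continuous.
apply: (@continuous_min R R id (fun=> T) t); first exact: cvg_id.
exact: cst_continuous.
Qed.

Lemma clamp_comp (T : R) (h : R -> R) : 0 < T -> {within Icl T, continuous h} ->
  continuous (fun t => h (clamp T t)).
Proof.
move=> T0 /subspace_continuousP ch t.
apply: (@cvg_comp _ _ _ (clamp T) h _ (within (Icl T) (nbhs (clamp T t)))); last first.
  by apply: ch; exact: clamp_in.
move=> P; rewrite /within /= => nP.
have : nbhs t (clamp T @^-1` [set s | Icl T s -> P s]) by exact: clamp_continuous.
by apply: filterS => s H; apply: H; exact: clamp_in.
Qed.

(** * Continuous functions on the closed space-time box, and their integrals in space *)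

Section Box.
Variables (L T : R) (L0 : 0 < L) (T0 : 0 < T).

Lemma box_compact : compact (box L T).
Proof.
have -> : box L T = Icl T `*` Icl L by [].
by apply: compact_setX; exact: Icl_compact.
Qed.

Lemma box_bounded (g : R * R -> R) : {within box L T, continuous g} ->
  exists B : R, 0 <= B /\ forall t x, Icl T t -> Icl L x -> `|g (t, x)| <= B.
Proof.
move=> cg; have /compact_bounded[M [_ HM]] := continuous_compact cg box_compact.
(* [compact_bounded] gives a bound by every number strictly above [M]; this one is moreover
   nonnegative. *)
exists (`|M| + 1); split; first by rewrite addr_ge0.
move=> t x It Ix; apply: (HM (`|M| + 1)); last by exists (t, x).
by rewrite (le_lt_trans (ler_norm _))// ltrDl.
Qed.

Lemma box_slice_x (g : R * R -> R) t : {within box L T, continuous g} -> Icl T t ->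
  {within Icl L, continuous (fun x => g (t, x))}.
Proof.
move=> /subspace_continuousP cg It; apply/subspace_continuousP => x Ix.
apply: (@cvg_comp _ _ _ (fun x => (t, x)) g _ (within (box L T) (nbhs (t, x)))); last exact: cg.
move=> P; rewrite /within /= => nP.
have cv : (t, y) @[y --> x] --> (t, x).
  exact: (@cvg_pair _ _ _ (nbhs x) (nbhs t) (nbhs x) _ _ _ (fun=> t) id (cvg_cst t) cvg_id).
have : nbhs x ((fun y => (t, y)) @^-1` [set p | box L T p -> P p]) by exact: cv.
by apply: filterS => y H Iy; apply: H.
Qed.

Lemma box_slice_t (g : R * R -> R) x : {within box L T, continuous g} -> Icl L x ->
  {within Icl T, continuous (fun t => g (t, x))}.
Proof.
move=> /subspace_continuousP cg Ix; apply/subspace_continuousP => t It.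
apply: (@cvg_comp _ _ _ (fun t => (t, x)) g _ (within (box L T) (nbhs (t, x)))); last exact: cg.
move=> P; rewrite /within /= => nP.
have cv : (s, x) @[s --> t] --> (t, x).
  exact: (@cvg_pair _ _ _ (nbhs t) (nbhs t) (nbhs x) _ _ _ id (fun=> x) cvg_id (cvg_cst x)).
have : nbhs t ((fun s => (s, x)) @^-1` [set p | box L T p -> P p]) by exact: cv.
by apply: filterS => y H Iy; apply: H.
Qed.

Lemma box_lift_x (h : R -> R) : {within Icl L, continuous h} ->
  {within box L T, continuous (fun p : R * R => h p.2)}.
Proof.
move=> /subspace_continuousP ch; apply/subspace_continuousP => -[t x] [It Ix].
apply: (@cvg_comp _ _ _ (fun p : R * R => p.2) h _ (within (Icl L) (nbhs x))); last exact: ch.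
move=> P; rewrite /within /= => nP.
have cv : (p : R * R).2 @[p --> (t, x)] --> x by exact: cvg_snd.
have : nbhs (t, x) ((fun p => p.2) @^-1` [set y | Icl L y -> P y]) by exact: cv.
by apply: filterS => y H [_ Iy]; apply: H.
Qed.

Lemma continuous_Rintegral_box (g : R * R -> R) : {within box L T, continuous g} ->
  {within Icl T, continuous (fun t => Rintegral Leb (Icl L) (fun x => g (t, x)))}.
Proof.
move=> cg; have [B [B0 HB]] := box_bounded cg.
(* [continuity_under_integral] is about open intervals, hence the clamping. *)
pose f t x := g (clamp T t, x).
have cf : {in `]-1, (T + 1)[%classic, continuous (fun t => Rintegral Leb (Icl L) (f t))}.
  apply: (@continuity_under_integral _ _ _ Leb f (Icl L) _ (-1) (T + 1) _ _ (fun=> B)).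
  - exact: measurable_Icl.
  - by move=> t _; apply/Icl_integrable/box_slice_x => //; exact: clamp_in.
  - apply: aeW => x Ix t _; apply: (@clamp_comp T (fun t => g (t, x)) T0).
    exact: box_slice_t.
  - by apply: Icl_integrable; apply: continuous_subspaceT; exact: cst_continuous.
  - by move=> t _; apply: aeW => x Ix; apply: HB => //; exact: clamp_in.
apply: (@subspace_eq_continuous _ _ _ (fun t => Rintegral Leb (Icl L) (f t))).
  move=> t; rewrite inE => It; rewrite /=; apply: eq_Rintegral => x _.
  by rewrite /f clamp_id.
apply: continuous_in_subspaceT => t; rewrite inE IclP => /andP[t0 tT].
by apply: cf; rewrite inE /= in_itv /=; apply/andP; split; lra.
Qed.

(** Differentiation under the integral sign; the time derivative is dominated by the constant that
    bounds [gt] on the compact box. *)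
Lemma is_derive_Rintegral_box (g gt : R * R -> R) t :
  {within box L T, continuous g} -> {within box L T, continuous gt} ->
  (forall s x, Iop T s -> Icl L x -> is_derive s 1 (fun s => g (s, x)) (gt (s, x))) ->
  Iop T t ->
  is_derive t 1 (fun t => Rintegral Leb (Icl L) (fun x => g (t, x)))
     (Rintegral Leb (Icl L) (fun x => gt (t, x))).
Proof.
move=> cg cgt dg It; have [B [B0 HB]] := box_bounded cgt.
pose f t x := g (t, x).
have d1 s x : Iop T s -> Icl L x -> partial1of2 f s x = gt (s, x).
  by move=> Is Ix; rewrite partial1of2E; have [_ ->] := dg _ _ Is Ix.
have It' : `]0, T[%classic t by rewrite -IopE.
have := @cvg_differentiation_under_integral _ _ _ Leb f (Icl L) (measurable_Icl L)
  t 0 T It' _ _ (fun=> B).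
rewrite -IopE => H.
have {}H := H (fun s Is => Icl_integrable (box_slice_x cg (Iop_Icl Is))).
have {}H := H (fun s x Is Ix => @ex_derive _ _ _ _ _ _ _ (dg s x Is Ix)).
have {}H := H (fun=> B0) (Icl_integrable (continuous_subspaceT (@cst_continuous _ _ _))).
have {}H : h^-1 *: (Rintegral Leb (Icl L) (f (h + t)) - Rintegral Leb (Icl L) (f t))
  @[h --> 0^'] --> Rintegral Leb (Icl L) (partial1of2 f t).
  by apply: H => s x Is Ix; have := HB s x (Iop_Icl Is) Ix; rewrite -d1.
have E : Rintegral Leb (Icl L) (partial1of2 f t) = Rintegral Leb (Icl L) (fun x => gt (t, x)).
  by apply: eq_Rintegral => x; rewrite inE => Ix; exact: d1.
rewrite -E; apply: DeriveDef.
  apply/cvg_ex; exists (Rintegral Leb (Icl L) (partial1of2 f t)) => /=.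
  by under eq_fun do rewrite scaler1.
rewrite /derive; under eq_fun do rewrite scaler1.
exact/cvg_lim.
Qed.

End Box.

(** * Fundamental theorem of calculus, vanishing integrals and Gronwall's lemma *)

Lemma Rintegral_FTC2 (L : R) (G g : R -> R) : 0 < L ->
  {within Icl L, continuous G} -> {within Icl L, continuous g} ->
  (forall x, Iop L x -> is_derive x 1 G (g x)) ->
  Rintegral Leb (Icl L) g = G L - G 0.
Proof.
move=> L0; rewrite IclE => cG cg dG.
rewrite /Rintegral (@continuous_FTC2 _ g G) //.
- have /(continuous_within_itvP _ L0) [_ c0 cL] := cG; split => // x xI.
  have /dG[] // : Iop L x by rewrite IopE.
- move=> x xI; rewrite derive1E.
  by have /dG[_ ->] // : Iop L x by rewrite IopE.
Qed.

Lemma is_derive_Rintegral_sup (T : R) (D : R -> R) t :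
  {within Icl T, continuous D} -> Iop T t ->
  is_derive t 1 (fun t => Rintegral Leb (Icl t) D) (D t).
Proof.
move=> cD It; have /andP[t0 tT] := (IopP T t).1 It.
have iD := Icl_integrable cD; rewrite IclE in iD cD.
have ct : {for t, continuous D}.
  apply: within_continuous_continuous cD _; first exact: lt_trans tT.
  by rewrite in_itv /= t0.
have [d e] := continuous_FTC1_closed tT iD t0 ct.
have -> : (fun t => Rintegral Leb (Icl t) D) =
    (fun t => Rintegral Leb `[0, t]%classic D).
  by apply/funext => y; rewrite IclE.
by apply: DeriveDef; [exact: d|rewrite -derive1E; exact: e].
Qed.

Lemma continuous_Rintegral_sup (T : R) (D : R -> R) : 0 < T ->
  {within Icl T, continuous D} ->
  {within Icl T, continuous (fun t => Rintegral Leb (Icl t) D)}.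
Proof.
move=> T0 cD; have iD := Icl_integrable cD.
have -> : (fun t => Rintegral Leb (Icl t) D) =
    (fun t => Rintegral Leb `[0, t]%classic D).
  by apply/funext => t; rewrite IclE.
rewrite IclE in iD *.
exact: parameterized_integral_continuous (ltW T0) iD.
Qed.

Lemma Rintegral_Icl0 (D : R -> R) : Rintegral Leb (Icl 0) D = 0.
Proof. by rewrite IclE set_itv1 Rintegral_set1. Qed.

(** The primitive of [g] is nondecreasing, starts at 0 and ends at most at 0. Hence it vanishes on
    the whole interval, and so does its derivative [g] in the interior. *)
Lemma Rintegral_eq0_continuous (L : R) (g : R -> R) x : 0 < L ->
  {within Icl L, continuous g} -> (forall y, Icl L y -> 0 <= g y) ->
  Rintegral Leb (Icl L) g <= 0 -> Iop L x -> g x = 0.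
Proof.
move=> L0 cg g0 gI xI.
pose G y := Rintegral Leb (Icl y) g.
have Gd y : Iop L y -> is_derive y 1 G (g y) by exact: is_derive_Rintegral_sup.
have mG : {in `[0, L] &, {homo G : x y / x <= y}}.
  apply: ger0_derive1_le_cc.
  - by move=> y yI; have [] : is_derive y 1 G (g y) by apply: Gd; rewrite IopE.
  - move=> y yI; rewrite derive1E.
    have Iy : Iop L y by rewrite IopE.
    by have [_ ->] := Gd _ Iy; apply: g0; exact: Iop_Icl.
  - by rewrite -IclE; exact: continuous_Rintegral_sup.
have G0 y : Icl L y -> G y = 0.
  move=> yI; have /andP[y0 yL] := (IclP _ _).1 yI.
  apply/eqP; rewrite eq_le; apply/andP; split.
    by apply: le_trans gI; apply: mG => //; rewrite in_itv /= ?y0 ?lexx ?(ltW L0).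
  have := Rintegral_Icl0 g; rewrite -/(G 0) => <-.
  by apply: mG => //; rewrite in_itv /= ?y0 ?lexx ?(ltW L0).
have [_ <-] := Gd x xI.
have /near_eq_derive -> : \forall y \near x, G y = (fun=> 0) y.
  by apply: filterS (Icl_nbhs xI) => y; exact: G0.
by rewrite derive_cst.
Qed.

(** The derivative of [H s * expR (- C * s)] is nonpositive. Differentiability is asked at interior
    times only, where the equation holds; continuity carries the comparison to the endpoints. *)
Lemma gronwall (T C : R) (H h : R -> R) t : 0 < T ->
  {within Icl T, continuous H} ->
  (forall s, Iop T s -> is_derive s 1 H (h s)) ->
  (forall s, Iop T s -> h s <= C * H s) ->
  Icl T t -> H t <= H 0 * expR (C * t).
Proof.
move=> T0 cH dH hH It.
pose G s := H s * expR (- C * s).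
have dG s : Iop T s -> is_derive s 1 G ((h s - C * H s) * expR (- C * s)).
  move=> Is; have Hs := dH _ Is.
  have es : is_derive s 1 (fun s => expR (- C * s)) (expR (- C * s) * (- C)).
    apply: (@is_derive1_comp _ expR (fun s => - C * s)).
    rewrite -[X in is_derive _ _ _ X]mulr1.
    exact: (@is_deriveZ R R R id (- C) s 1 1 (is_derive_id s 1)).
  have := is_deriveM Hs es; rewrite /GRing.scale /=.
  by move=> /is_derive_eq; apply; ring.
have mG : {in `[0, T] &, {homo G : x y /~ x <= y}}.
  apply: ler0_derive1_le_cc.
  - move=> s sI; have Is : Iop T s by rewrite IopE.
    by have [] := dG _ Is.
  - move=> s sI; have Is : Iop T s by rewrite IopE.
    rewrite derive1E; have [_ ->] := dG _ Is.
    by rewrite mulr_le0_ge0 ?expR_ge0// subr_le0 hH.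
  - rewrite -IclE; move=> s; apply: cvgM; first exact: cH.
    apply: continuous_subspaceT => {}s.
    apply: (@continuous_comp _ _ _ (fun s => - C * s) expR); last exact: continuous_expR.
    exact: mulrl_continuous.
have /andP[t0 tT] := (IclP _ _).1 It.
have : G t <= G 0 by apply: mG => //; rewrite in_itv /= ?t0 ?lexx ?(ltW T0).
rewrite /G mulr0 expR0 mulr1 mulNr expRN ler_pdivrMr ?expR_gt0//.
Qed.

End IntegralToolbox.

(** * The energy identity *)

Section WithinContinuous.
Variables (R : realType) (U : topologicalType) (A : set U).
Implicit Types f g : U -> R.

Lemma within_comp f (h : R -> R) : {within A, continuous f} ->
  (forall x, A x -> {for f x, continuous h}) ->
  {within A, continuous (fun x => h (f x))}.
Proof.
move=> /subspace_continuousP cf ch; apply/subspace_continuousP => x Ax.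
by apply: (@cvg_comp _ _ _ f h _ (nbhs (f x))); [exact: cf|exact: ch].
Qed.

Lemma within_add f g : {within A, continuous f} -> {within A, continuous g} ->
  {within A, continuous (fun x => f x + g x)}.
Proof. by move=> cf cg x; apply: cvgD; [exact: cf|exact: cg]. Qed.

Lemma within_mul f g : {within A, continuous f} -> {within A, continuous g} ->
  {within A, continuous (fun x => f x * g x)}.
Proof. by move=> cf cg x; apply: cvgM; [exact: cf|exact: cg]. Qed.

Lemma within_cst (c : R) : {within A, continuous (fun=> c)}.
Proof. by move=> x; exact: cvg_cst. Qed.

Lemma within_scale f (c : R) : {within A, continuous f} ->
  {within A, continuous (fun x => c * f x)}.
Proof. by apply: within_mul; exact: within_cst. Qed.

Lemma within_eq f g : (forall x, A x -> f x = g x) -> {within A, continuous f} ->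
  {within A, continuous g}.
Proof.
move=> fg; apply: subspace_eq_continuous => x; rewrite inE => Ax; exact: fg.
Qed.

End WithinContinuous.

Lemma is_derive_continuous (R : realType) (h : R -> R) (x d : R) :
  is_derive x 1 h d -> {for x, continuous h}.
Proof. by case=> dh _; apply: differentiable_continuous; exact/derivable1_diffP. Qed.

Lemma Rintegral_Icl1 (R : realType) (L : R) : 0 < L ->
  Rintegral Leb (Icl L) (fun=> 1) = L.
Proof.
move=> L0; have cid : {within Icl L, continuous (@id R)}.
  by apply: continuous_subspaceT => x; exact: cvg_id.
have := Rintegral_FTC2 L0 cid (@within_cst R R (Icl L) 1) (fun x _ => is_derive_id x 1).
by rewrite /= subr0.
Qed.

(** * Time derivative of the integral of [Phi (u t x)] for a conservation law *)

Section Energy.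
Variables (R : realType) (L T : R) (L0 : 0 < L) (T0 : 0 < T).
Variables (u ux ut F : R -> R -> R) (Phi Phi1 Phi2 : R -> R) (P : set R).
Hypothesis cu : {within box L T, continuous (fun p => u p.1 p.2)}.
Hypothesis cux : {within box L T, continuous (fun p => ux p.1 p.2)}.
Hypothesis cut : {within box L T, continuous (fun p => ut p.1 p.2)}.
Hypothesis uP : forall t x, Icl T t -> Icl L x -> P (u t x).
Hypothesis du : forall t x, Iop T t -> Iop L x -> is_derive x 1 (u t) (ux t x).
Hypothesis dut : forall t x, Iop T t -> Icl L x ->
  is_derive t 1 (fun s => u s x) (ut t x).
Hypothesis dPhi : forall s, P s -> is_derive s 1 Phi (Phi1 s).
Hypothesis dPhi1 : forall s, P s -> is_derive s 1 Phi1 (Phi2 s).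
Hypothesis cPhi2 : forall s, P s -> {for s, continuous Phi2}.
Hypothesis cF : forall t, Iop T t -> {within Icl L, continuous (F t)}.
Hypothesis dF : forall t x, Iop T t -> Iop L x -> is_derive x 1 (F t) (ut t x).
Hypothesis F0 : forall t, Iop T t -> F t 0 = 0.
Hypothesis FL : forall t, Iop T t -> F t L = 0.

Let cPhiu : {within box L T, continuous (fun p => Phi (u p.1 p.2))}.
Proof.
apply: within_comp cu _ => -[t x] [It Ix].
exact: is_derive_continuous (dPhi (uP It Ix)).
Qed.

Let cPhi1u : {within box L T, continuous (fun p => Phi1 (u p.1 p.2))}.
Proof.
apply: within_comp cu _ => -[t x] [It Ix].
exact: is_derive_continuous (dPhi1 (uP It Ix)).
Qed.

Let cPhi2u : {within box L T, continuous (fun p => Phi2 (u p.1 p.2))}.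
Proof. by apply: within_comp cu _ => -[t x] [It Ix]; exact/cPhi2/uP. Qed.

Lemma energy_continuous :
  {within Icl T, continuous (fun t => Rintegral Leb (Icl L) (fun x => Phi (u t x)))}.
Proof. exact: (continuous_Rintegral_box T0 cPhiu). Qed.

Lemma energy_integrand_continuous t : Iop T t ->
  {within Icl L, continuous (fun x => Phi2 (u t x) * ux t x * F t x)}.
Proof.
move=> It; have It' := Iop_Icl It.
apply: within_mul; last exact: cF.
by apply: within_mul; [exact: (box_slice_x cPhi2u)|exact: (box_slice_x cux)].
Qed.

(** Differentiation under the integral followed by integration by parts, whose boundary terms vanish
    with [F]. The set [P] contains the values of [u]: it will be the whole line for the negative
    part and the positive half-line for the negative power. *)
Lemma energy_identity t : Iop T t ->
  is_derive t 1 (fun t => Rintegral Leb (Icl L) (fun x => Phi (u t x)))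
    (- Rintegral Leb (Icl L) (fun x => Phi2 (u t x) * ux t x * F t x)).
Proof.
move=> It; have It' := Iop_Icl It.
have cPu := within_mul cPhi1u cut.
have H s x : Iop T s -> Icl L x ->
    is_derive s 1 (fun s => Phi (u s x)) (Phi1 (u s x) * ut s x).
  move=> Is Ix.
  have := is_derive1_comp (dPhi (uP (Iop_Icl Is) Ix)) (dut Is Ix).
  by [].
have dE := @is_derive_Rintegral_box R L T (fun p => Phi (u p.1 p.2))
    (fun p => Phi1 (u p.1 p.2) * ut p.1 p.2) t cPhiu cPu H It.
suff <- : Rintegral Leb (Icl L) (fun x => Phi1 (u t x) * ut t x) =
    - Rintegral Leb (Icl L) (fun x => Phi2 (u t x) * ux t x * F t x) by exact: dE.
have c1 := energy_integrand_continuous It.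
have c2 := box_slice_x cPu It'.
have cG : {within Icl L, continuous (fun x => Phi1 (u t x) * F t x)}.
  by apply: within_mul; [exact: (box_slice_x cPhi1u)|exact: cF].
(* The product rule for [Phi1 (u) * F] yields both integrands at once, since the space derivative of
   [F] is [ut]. *)
have dG x : Iop L x -> is_derive x 1 (fun x => Phi1 (u t x) * F t x)
    (Phi2 (u t x) * ux t x * F t x + Phi1 (u t x) * ut t x).
  move=> Ix.
  have d1 := is_derive1_comp (dPhi1 (uP It' (Iop_Icl Ix))) (du It Ix).
  have := is_deriveM d1 (dF It Ix); rewrite /GRing.scale /= => d2.
  have -> : Phi2 (u t x) * ux t x * F t x + Phi1 (u t x) * ut t x =
    Phi1 (u t x) * ut t x + F t x * (Phi2 (u t x) * ux t x) by ring.
  exact: d2.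
have := Rintegral_FTC2 L0 cG (within_add c1 c2) dG.
rewrite F0// FL// !mulr0 subrr.
rewrite (RintegralD (measurable_Icl L) (Icl_integrable c1) (Icl_integrable c2)) /=.
by move/eqP; rewrite addrC addr_eq0 => /eqP.
Qed.

End Energy.

(** * The flux of a classical solution *)

Section Flux.
Variables (R : realType) (L T : R) (L0 : 0 < L) (T0 : 0 < T).

(** Derivatives are carried as explicit functions, so that the sum of the two densities is again an
    instance and is treated like each of them. The time derivative is taken at interior times, where
    it is two-sided. *)
Record smooth_in_box (u ux uxx ut : R -> R -> R) : Prop := SmoothInBox {
  smooth_cont : {within box L T, continuous (fun p => u p.1 p.2)};
  smooth_cont_x : {within box L T, continuous (fun p => ux p.1 p.2)};
  smooth_cont_t : {within box L T, continuous (fun p => ut p.1 p.2)};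
  smooth_dx : forall t x, Icl T t -> Icl L x -> has_dw (Icl L) (u t) x (ux t x);
  smooth_dxx : forall t x, Icl T t -> Icl L x -> has_dw (Icl L) (ux t) x (uxx t x);
  smooth_dt : forall t x, Iop T t -> Icl L x -> is_derive t 1 (fun s => u s x) (ut t x)
}.

Lemma sol_regular_smooth r : sol_regular L T r ->
  smooth_in_box r (fun t => dw (Icl L) (r t)) (fun t => iterd 2 (Icl L) (r t)) (dt T r).
Proof.
move=> [rx [rc [rt [_ [rtc _]]]]]; split.
- exact: (rc 0%N).
- exact: (rc 1%N).
- exact: rtc.
- by move=> t x It Ix; apply: Icl_has_dw => //; exact: (rx t It 0%N).
- by move=> t x It Ix; apply: Icl_has_dw => //; exact: (rx t It 1%N).
- move=> t x It Ix; apply: (has_dw_is_derive (Icl_nbhs It)).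
  by apply: Icl_has_dw => //; [exact: Iop_Icl|apply: rt => //; exact: Iop_Icl].
Qed.

Lemma smoothD u ux uxx ut v vx vxx vt :
  smooth_in_box u ux uxx ut -> smooth_in_box v vx vxx vt ->
  smooth_in_box (fun t x => u t x + v t x) (fun t x => ux t x + vx t x)
    (fun t x => uxx t x + vxx t x) (fun t x => ut t x + vt t x).
Proof.
move=> [a1 a2 a3 a4 a5 a6] [b1 b2 b3 b4 b5 b6]; split.
- exact: within_add.
- exact: within_add.
- exact: within_add.
- by move=> t x It Ix; apply: has_dwD; [exact: a4|exact: b4].
- by move=> t x It Ix; apply: has_dwD; [exact: a5|exact: b5].
- by move=> t x It Ix; have := is_deriveD (a6 _ _ It Ix) (b6 _ _ It Ix).
Qed.

Lemma is_derive_fd f (j : nat) (s : R) : Ck_on 4 (@Pos R) f -> (j < 4)%N -> 0 < s ->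
  is_derive s 1 (fd j f) (fd j.+1 f s).
Proof.
move=> [df _] j4 s0; have nP := Pos_nbhs s0.
apply: (has_dw_is_derive nP); apply: derivable_withinP.
  exact: dq_filter_proper_nbhs.
by apply: df => //; exact/PosP.
Qed.

Lemma C31_has_dw V (j : nat) (x : R) : C31 L V -> (j < 3)%N -> Icl L x ->
  has_dw (Icl L) (iterd j (Icl L) V) x (iterd j.+1 (Icl L) V x).
Proof. by move=> [[dV _] _] j3 Ix; apply: Icl_has_dw => //; exact: dV. Qed.

Lemma C31_continuous_dw V : C31 L V -> {within Icl L, continuous (dw (Icl L) V)}.
Proof. by move=> [[_ cV] _]; exact: (cV 1%N). Qed.

(** The Lipschitz constant bounds every difference quotient, hence their limit. *)
Lemma dw_lip V (C x : R) : C31 L V -> lip_on (Icl L) C V -> Iop L x ->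
  `|dw (Icl L) V x| <= C.
Proof.
move=> cV lV Ix; have Ix' := Iop_Icl Ix.
have := C31_has_dw (j := 0%N) cV isT Ix'; rewrite /has_dw /= => cvV.
have PF := Icl_proper L0 Ix'.
have cvN : `|dquot V x h| @[h --> dq_filter (Icl L) x] --> `|dw (Icl L) V x|.
  exact: cvg_norm.
have E := cvg_lim (@Rhausdorff R) cvN; rewrite -E.
apply: limr_le; first by apply/cvg_ex; exists `|dw (Icl L) V x|.
have : dq_filter (Icl L) x [set h | `|dquot V x h| <= C].
  apply: dq_filterE; apply: filterE => h h0 Ih /=.
  rewrite /dquot normrM normfV ler_pdivrMl ?normr_gt0// mulrC.
  by have := lV _ _ Ih Ix'; rewrite addrAC subrr add0r.
by [].
Qed.

Section Species.
Variables (eta : R) (f V : R -> R).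
Variables (r rx rxx rt s sx sxx st : R -> R -> R).
Hypothesis cf : Ck_on 4 (@Pos R) f.
Hypothesis cV : C31 L V.
Hypothesis sr : smooth_in_box r rx rxx rt.
Hypothesis ss : smooth_in_box s sx sxx st.
Hypothesis s_gt0 : forall t x, Icl T t -> Icl L x -> 0 < s t x.

(** The space derivative of the potential [fd 1 f (s t x) + V x], with the chain rule carried out.
    In this form it is visibly continuous on the closed box, hence bounded. *)
Definition drift t x := fd 2 f (s t x) * sx t x + dw (Icl L) V x.

Lemma drift_continuous : {within box L T, continuous (fun p => drift p.1 p.2)}.
Proof.
apply: within_add; last by apply: box_lift_x; exact: C31_continuous_dw.
apply: within_mul; last exact: smooth_cont_x ss.
apply: within_comp (smooth_cont ss) _ => -[t x] [It Ix].
exact: is_derive_continuous (is_derive_fd cf (isT : (2 < 4)%N) (s_gt0 It Ix)).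
Qed.

Let has_dw_drift_potential t x : Icl T t -> Icl L x ->
  has_dw (Icl L) (fun z => fd 1 f (s t z) + V z) x (drift t x).
Proof.
move=> It Ix; apply: has_dwD; last exact: (C31_has_dw (j := 0%N) cV).
apply: has_dw_comp (smooth_dx ss It Ix).
exact: (is_derive_fd cf (isT : (1 < 4)%N)) (s_gt0 It Ix).
Qed.

Lemma fluxE t x : Icl T t -> Icl L x ->
  flux L eta f V (r t) (s t) x = eta * rx t x + r t x * drift t x.
Proof.
move=> It Ix; rewrite /flux (Icl_dwE L0 Ix (smooth_dx sr It Ix)).
by rewrite (Icl_dwE L0 Ix (has_dw_drift_potential It Ix)).
Qed.

Lemma flux_continuous t : Icl T t ->
  {within Icl L, continuous (flux L eta f V (r t) (s t))}.
Proof.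
move=> It; apply: (@within_eq _ _ _ (fun x => eta * rx t x + r t x * drift t x)).
  by move=> x Ix; rewrite fluxE.
apply: within_add.
  by apply: within_scale; exact: (box_slice_x (smooth_cont_x sr) It).
apply: within_mul; first exact: (box_slice_x (smooth_cont sr) It).
exact: (box_slice_x drift_continuous It).
Qed.

Lemma is_derive_flux t x : Icl T t -> Iop L x ->
  is_derive x 1 (flux L eta f V (r t) (s t)) (Aop L eta f V (r t) (s t) x).
Proof.
move=> It Ix; have Ix' := Iop_Icl Ix.
(* The differentiation rules build some derivative [d]; its formula is irrelevant, because [Aop] is
   by definition [dw] of the flux and limits are unique. *)
have [d fd] : exists d, has_dw (Icl L) (flux L eta f V (r t) (s t)) x d.
  eexists; apply: (@has_dw_eq _ _ (fun x => eta * rx t x + r t x * drift t x)) => //.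
    by move=> y Iy; rewrite fluxE.
  apply: has_dwD; first by apply: has_dwZ; exact: (smooth_dxx sr It Ix').
  apply: has_dwM; first exact: (smooth_dx sr It Ix').
  apply: has_dwD; last exact: (C31_has_dw (j := 1%N) cV).
  apply: has_dwM; last exact: (smooth_dxx ss It Ix').
  apply: has_dw_comp (smooth_dx ss It Ix').
  exact: (is_derive_fd cf (isT : (2 < 4)%N)) (s_gt0 It Ix').
rewrite /Aop (Icl_dwE L0 Ix' fd).
exact: has_dw_is_derive (Icl_nbhs Ix) fd.
Qed.

End Species.
End Flux.

(** * Nonnegativity *)

Section NegativePart.
Variable R : realType.

Definition negpart (s : R) : R := Num.max (- s) 0.

Lemma negpart_ge0 s : 0 <= negpart s.
Proof. by rewrite /negpart le_max lexx orbT. Qed.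

Lemma negpart_mul s : s * negpart s = - negpart s ^+ 2.
Proof.
rewrite /negpart; have [s0|s0] := leP 0 s; first by rewrite max_r ?oppr_le0// expr0n/= mulr0 oppr0.
by rewrite max_l ?oppr_ge0 ?ltW//; ring.
Qed.

Lemma negpart_eq0 s : (negpart s == 0) = (0 <= s).
Proof.
rewrite /negpart; have [s0|s0] := leP 0 s; first by rewrite max_r ?oppr_le0// eqxx.
by rewrite max_l ?oppr_ge0 ?ltW// oppr_eq0 lt_eqF.
Qed.

Lemma negpart_continuous : continuous negpart.
Proof.
move=> s; apply: (@continuous_max R R (fun s => - s) (fun=> 0) s).
  exact: (@oppr_continuous _ R).
exact: cst_continuous.
Qed.

(** Away from 0 the function agrees locally with a power of [- s] or with 0. At 0 the Carathéodory
    slope is [- negpart z ^+ k], which is continuous and vanishes there because [0 < k]. *)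
Lemma is_derive_negpart_exp (k : nat) (s : R) : (0 < k)%N ->
  is_derive s 1 (fun s => negpart s ^+ k.+1) (- (k.+1%:R * negpart s ^+ k)).
Proof.
move=> k0; have [s0|s0|->] := ltgtP s 0.
- have dN : is_derive s 1 (fun s => (- s) ^+ k.+1) (- (k.+1%:R * negpart s ^+ k)).
    rewrite /negpart max_l ?oppr_ge0 ?ltW//.
    have d1 : is_derive s 1 (fun s : R => - s) (-1) by exact: is_deriveN (is_derive_id s 1).
    have := @is_deriveX R R (fun s : R => - s) k.+1 s 1 (-1) d1.
    by rewrite /GRing.scale /= mulrN1 exprfctE.
  apply: near_eq_is_derive dN.
  have : nbhs s [set y | y < 0] by exact: lt_nbhsl.
  by apply: filterS => y y0; rewrite /negpart max_l ?oppr_ge0 ?ltW.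
- have -> : - (k.+1%:R * negpart s ^+ k) = 0 :> R.
    rewrite /negpart max_r ?oppr_le0 ?ltW// expr0n.
    by case: k k0 => // k _; rewrite mulr0 oppr0.
  apply: near_eq_is_derive (is_derive_cst 0 s 1).
  have : nbhs s [set y | 0 < y] by exact: lt_nbhsr.
  by apply: filterS => y y0; rewrite /negpart max_r ?oppr_le0 ?ltW// expr0n.
- have N0 : negpart 0 = 0 by apply/eqP; rewrite negpart_eq0.
  apply/is_derive1_caratheodory; exists (fun z => - negpart z ^+ k); split.
  + move=> z; rewrite N0 expr0n /= !subr0 exprSr.
    case: k k0 => // k _; rewrite exprSr mulNr -!mulrA (mulrC _ z) negpart_mul.
    by rewrite mulrN opprK expr2.
  + apply: (@continuous_comp _ _ _ negpart (fun y => - y ^+ k)); first exact: negpart_continuous.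
    by apply: (@cvgN R R); exact: exprn_continuous.
  + by rewrite N0 expr0n; case: k k0 => // k _; rewrite mulr0.
Qed.

End NegativePart.

(** * Each density stays nonnegative *)

Section Nonnegativity.
Variables (R : realType) (L T : R) (L0 : 0 < L) (T0 : 0 < T).
Variables (eta : R) (f V : R -> R).
Variables (r rx rxx rt s sx sxx st : R -> R -> R).
Hypothesis eta0 : 0 < eta.
Hypothesis cf : Ck_on 4 (@Pos R) f.
Hypothesis cV : C31 L V.
Hypothesis sr : smooth_in_box L T r rx rxx rt.
Hypothesis ss : smooth_in_box L T s sx sxx st.
Hypothesis s_gt0 : forall t x, Icl T t -> Icl L x -> 0 < s t x.
Hypothesis r0 : forall x, Icl L x -> 0 <= r 0 x.
Hypothesis pde : forall t x, Iop T t -> Iop L x -> rt t x = Aop L eta f V (r t) (s t) x.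
Hypothesis bc0 : forall t, Iop T t -> flux L eta f V (r t) (s t) 0 = 0.
Hypothesis bcL : forall t, Iop T t -> flux L eta f V (r t) (s t) L = 0.

(** Completing the square [(2 * e * p - n * b) ^+ 2]. Here [n] stands for the negative part of the
    density, [p] for its space derivative, [b] for the drift and [e] for the viscosity; the factor
    [6 * n] is the second derivative of the cubed negative part. *)
Lemma young_negpart (e B b n p : R) : 0 < e -> 0 <= n -> `|b| <= B ->
  - (6 * n * p * (e * p)) + 6 * n ^+ 2 * p * b <= 6 * B ^+ 2 / (4 * e) * n ^+ 3.
Proof.
move=> e0 n0 bB.
have b2 : b ^+ 2 <= B ^+ 2.
  by rewrite -real_normK ?num_real// lerXn2r// nnegrE (le_trans _ bB).
have H : - (e * p ^+ 2) + n * p * b <= B ^+ 2 / (4 * e) * n ^+ 2.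
  have e4 : 0 < 4 * e by rewrite mulr_gt0.
  rewrite [leRHS]mulrAC ler_pdivlMr//.
  have : 0 <= (2 * e * p - n * b) ^+ 2 by exact: sqr_ge0.
  have : b ^+ 2 * n ^+ 2 <= B ^+ 2 * n ^+ 2 by rewrite ler_wpM2r ?sqr_ge0.
  nra.
have : 6 * n * (- (e * p ^+ 2) + n * p * b) <= 6 * n * (B ^+ 2 / (4 * e) * n ^+ 2).
  by rewrite ler_wpM2l// mulr_ge0.
have -> : 6 * n * (- (e * p ^+ 2) + n * p * b) = - (6 * n * p * (e * p)) + 6 * n ^+ 2 * p * b by ring.
move/le_trans; apply; rewrite le_eqVlt; apply/orP; left; apply/eqP; ring.
Qed.

Lemma solution_ge0 t x : Icl T t -> Iop L x -> 0 <= r t x.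
Proof.
move=> It Ix.
have [B [B0 HB]] := box_bounded (drift_continuous cf cV ss s_gt0).
(* This rate blows up as [eta] tends to 0, which is harmless: it will multiply an initial energy
   equal to 0. *)
pose C := 6 * B ^+ 2 / (4 * eta).
(* The cube is the lowest integer power of the negative part with a continuous second derivative. *)
pose Phi (y : R) := negpart y ^+ 3.
pose Phi1 (y : R) := - (3 * negpart y ^+ 2).
pose Phi2 (y : R) := 6 * negpart y.
pose F t := flux L eta f V (r t) (s t).
have dPhi (y : R) : setT y -> is_derive y 1 Phi (Phi1 y) by move=> _; exact: is_derive_negpart_exp.
have dPhi1 (y : R) : setT y -> is_derive y 1 Phi1 (Phi2 y).
  move=> _; have d := is_deriveZ (-3) (is_derive_negpart_exp y (isT : (0 < 1)%N)).
  have e : Phi1 = (-3) \*: (fun y => negpart y ^+ 2).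
    by apply/funext => z; rewrite /Phi1 /= /GRing.scale /= mulNr.
  rewrite e; have -> : Phi2 y = -3 *: - (2%:R * negpart y ^+ 1); last exact: d.
  by rewrite /GRing.scale /= expr1 /Phi2; ring.
have cPhi2 (y : R) : setT y -> {for y, continuous Phi2}.
  move=> _; apply: (@continuous_comp _ _ _ (@negpart R) (fun z => 6 * z)).
    exact: negpart_continuous.
  exact: mulrl_continuous.
have du (t' x' : R) : Iop T t' -> Iop L x' -> is_derive x' 1 (r t') (rx t' x').
  move=> It' Ix'; apply: (has_dw_is_derive (Icl_nbhs Ix')).
  exact: (smooth_dx sr (Iop_Icl It') (Iop_Icl Ix')).
have cF t' : Iop T t' -> {within Icl L, continuous (F t')}.
  by move=> It'; apply: (flux_continuous L0 cf cV sr ss s_gt0); exact: Iop_Icl.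
have dF (t' x' : R) : Iop T t' -> Iop L x' -> is_derive x' 1 (F t') (rt t' x').
  move=> It' Ix'; rewrite pde//.
  by apply: (is_derive_flux L0 eta cf cV sr ss s_gt0) => //; exact: Iop_Icl.
have uP t' x' : Icl T t' -> Icl L x' -> (setT : set R) (r t' x') by [].
have cE := energy_continuous T0 (smooth_cont sr) uP dPhi.
have cI := energy_integrand_continuous (smooth_cont sr) (smooth_cont_x sr) uP cPhi2 cF.
have dE := energy_identity L0 (smooth_cont sr) (smooth_cont_x sr) (smooth_cont_t sr)
  uP du (smooth_dt sr) dPhi dPhi1 cPhi2 cF dF bc0 bcL.
have cP t' : Icl T t' -> {within Icl L, continuous (fun x => Phi (r t' x))}.
  move=> It'; apply: (within_comp (box_slice_x (smooth_cont sr) It')) => y Iy.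
  exact: is_derive_continuous (dPhi _ I).
have gr := gronwall (C := C) T0 cE dE _ It.
have Er : Rintegral Leb (Icl L) (fun x => Phi (r 0 x)) = 0.
  rewrite (@eq_Rintegral _ _ _ _ _ (fun=> 0)).
    by rewrite Rintegral_cst ?mul0r//; exact: measurable_Icl.
  move=> y; rewrite inE => Iy; rewrite /Phi.
  by have /eqP -> : negpart (r 0 y) == 0; rewrite ?negpart_eq0 ?r0// expr0n.
have : Rintegral Leb (Icl L) (fun x => Phi (r t x)) <= 0.
  move: gr; rewrite Er mul0r; apply => t' It'.
  have It'' := Iop_Icl It'.
  rewrite -RintegralZl; [|exact: measurable_Icl|exact: (Icl_integrable (cP _ It''))].
  rewrite -mulN1r -RintegralZl; [|exact: measurable_Icl|exact: (Icl_integrable (cI _ It'))].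
  apply: le_Rintegral.
  - exact: measurable_Icl.
  - by apply: Icl_integrable; apply: within_scale; exact: cI.
  - by apply: Icl_integrable; apply: within_scale; exact: cP.
  move=> y Iy; rewrite /F (fluxE L0 eta cf cV sr ss s_gt0)//.
  have bB := HB _ _ It'' Iy.
  have := young_negpart (rx t' y) eta0 (negpart_ge0 (r t' y)) bB.
  rewrite -/C; apply: le_trans; rewrite le_eqVlt; apply/orP; left; apply/eqP.
  have m := negpart_mul (r t' y); rewrite /Phi2 /=.
  (* Since [r] times its negative part is minus the square of the latter, the drift term of the flux
     takes the form required by [young_negpart]. *)
  have -> : negpart (r t' y) ^+ 2 = - (r t' y * negpart (r t' y)) by rewrite m opprK.
  ring.
move=> /(Rintegral_eq0_continuous L0 (cP _ It)) => /(_ x) H.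
have : Phi (r t x) = 0 by apply: H => // y _; rewrite exprn_ge0// negpart_ge0.
by rewrite -negpart_eq0 => /eqP; rewrite expf_eq0.
Qed.

End Nonnegativity.

(** * The energy estimate *)

Section PowerFunctions.
Variable R : realType.
Implicit Types s a b : R.

Lemma powRD_gt0 s a b : 0 < s -> s `^ (a + b) = s `^ a * s `^ b.
Proof. by move=> s0; apply: powRD; rewrite (gt_eqF s0) implybT. Qed.

Lemma sqr_powR_half s a : 0 < s -> (s `^ (a / 2)) ^+ 2 = s `^ a.
Proof. by move=> s0; rewrite expr2 -powRD_gt0// -splitr. Qed.

Lemma is_derive_powR a s : 0 < s -> is_derive s 1 (@powR R ^~ a) (a * s `^ (a - 1)).
Proof.
move=> s0; have si : s \in `]0, +oo[ by rewrite in_itv /= s0.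
by apply: DeriveDef; [exact: derivable_powR|rewrite -derive1E powR_derive1].
Qed.

(** For [1 <= s] a power with nonpositive exponent is at most 1; for [s < 1] the smaller exponent
    gives the larger power. *)
Lemma powR_le_1Dpow s a b : 0 < s -> b <= a -> a <= 0 -> s `^ a <= 1 + s `^ b.
Proof.
move=> s0 ba a0; have [s1|s1] := leP 1 s.
  apply: (@le_trans _ _ 1); last by rewrite lerDl powR_ge0.
  by rewrite -(powRr0 s); exact: ler_powR.
apply: (@le_trans _ _ (s `^ b)); last by rewrite lerDr.
by apply: ger_powR => //; rewrite s0 ltW.
Qed.

(* The drift term is absorbed in the dissipation by Young's inequality between
   [s^((alpha-theta-3)/2) * |p|] and [s^((1-alpha-theta)/2)]. *)
Lemma dissipation_pointwise (alpha theta eta lam a s p q G : R) :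
  alpha <= 1 -> 0 < theta -> 1 - alpha < theta -> 0 <= eta -> 0 < a -> 0 < s ->
  a * s `^ alpha <= s ^+ 2 * q -> 0 <= lam -> `|G| <= lam * s ->
  - (s `^ (- theta - 2) * p * (eta * p + s * q * p + G)) <=
  - (a / 2 * (s `^ ((alpha - theta - 3) / 2) * p) ^+ 2) +
    lam ^+ 2 / (2 * a) * (1 + s `^ (- theta)).
Proof.
move=> al1 th0 alth eta0 a0 s0 sq lam0 HG.
set P := s `^ ((alpha - theta - 3) / 2) * p.
set Q := s `^ ((1 - alpha - theta) / 2).
have Q0 : 0 <= Q by exact: powR_ge0.
have W0 : 0 <= s `^ (- theta - 2) by exact: powR_ge0.
have P2 : P ^+ 2 = s `^ (alpha - theta - 3) * p ^+ 2.
  by rewrite /P exprMn sqr_powR_half.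
(* The exponent [1 - alpha - theta] lies between [- theta] and 0, by [alpha <= 1] and
   [1 - alpha < theta]. *)
have Q2 : Q ^+ 2 <= 1 + s `^ (- theta).
  by rewrite /Q sqr_powR_half//; apply: powR_le_1Dpow => //; lra.
have WPQ : s `^ (- theta - 2) * s * `|p| = `|P| * Q.
  rewrite /P /Q normrM ger0_norm ?powR_ge0// [RHS]mulrAC -powRD_gt0//.
  rewrite -{2}(powRr1 (ltW s0)) -powRD_gt0//; congr (s `^ _ * _); lra.
(* The lower bound on [s ^+ 2 * q], multiplied by [s] to the power [- theta - 3] and by [p ^+ 2]. *)
have diss : a * P ^+ 2 <= s `^ (- theta - 2) * p * (s * q * p).
  have W3 : 0 <= s `^ (- theta - 3) by exact: powR_ge0.
  have := ler_wpM2l W3 sq.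
  have -> : s `^ (- theta - 3) * (a * s `^ alpha) = a * s `^ (alpha - theta - 3).
    by rewrite mulrCA -powRD_gt0//; congr (_ * s `^ _); ring.
  have -> : s `^ (- theta - 3) * (s ^+ 2 * q) = s `^ (- theta - 2) * (s * q).
    have -> : - theta - 2 = - theta - 3 + 1 by ring.
    by rewrite (powRD_gt0 (- theta - 3) 1 s0) powRr1 ?ltW//; ring.
  move=> /(ler_wpM2r (sqr_ge0 p)) H; rewrite P2 mulrA (le_trans H)//.
  by rewrite le_eqVlt; apply/orP; left; apply/eqP; ring.
(* The viscous term has a favourable sign and is dropped, so no constant depends on [eta]. *)
have visc : 0 <= s `^ (- theta - 2) * p * (eta * p).
  have -> : s `^ (- theta - 2) * p * (eta * p) = s `^ (- theta - 2) * eta * p ^+ 2 by ring.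
  by apply: mulr_ge0; [exact: mulr_ge0|exact: sqr_ge0].
have cross : - (s `^ (- theta - 2) * p * G) <= lam * (`|P| * Q).
  rewrite (le_trans (ler_norm _))// normrN -WPQ !normrM (ger0_norm W0).
  have -> : lam * (s `^ (- theta - 2) * s * `|p|) =
    s `^ (- theta - 2) * `|p| * (lam * s) by ring.
  by rewrite ler_wpM2l// mulr_ge0.
(* The gap between the two sides is a perfect square over [2 * a]. Only half of the dissipation
   [a * P ^+ 2] is spent; the other half survives in the conclusion. *)
have young : lam * (`|P| * Q) <= a / 2 * P ^+ 2 + lam ^+ 2 / (2 * a) * Q ^+ 2.
  rewrite -subr_ge0.
  have -> : a / 2 * P ^+ 2 + lam ^+ 2 / (2 * a) * Q ^+ 2 - lam * (`|P| * Q) =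
     (a * `|P| - lam * Q) ^+ 2 / (2 * a).
    by rewrite -(real_normK (num_real P)); field; rewrite gt_eqF.
  by rewrite divr_ge0 ?sqr_ge0// mulr_ge0// ltW.
have l2 : 0 <= lam ^+ 2 / (2 * a) by rewrite divr_ge0 ?sqr_ge0// mulr_ge0// ltW.
have yq := ler_wpM2l l2 Q2.
move: diss visc cross young yq; rewrite !mulrDr !opprD.
move: (lam ^+ 2 / (2 * a) * Q ^+ 2) (s `^ (- theta - 2)) => z W; nra.
Qed.

End PowerFunctions.

(** * The estimate for the total density [s] *)

Section Estimate.
Variables (R : realType) (L T : R) (L0 : 0 < L) (T0 : 0 < T).
Variables (alpha kappa theta eta lam : R) (f V1 V2 : R -> R).
Variables (r1 r1x r1xx r1t r2 r2x r2xx r2t : R -> R -> R).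
Hypothesis eta0 : 0 < eta.
Hypothesis alpha01 : 0 < alpha <= 1.
Hypothesis kappa0 : 0 < kappa.
Hypothesis alpha_theta : 1 - alpha < theta.
Hypothesis cf : Ck_on 4 (@Pos R) f.
Hypothesis fI2 : I2 alpha kappa f.
Hypothesis cV1 : C31 L V1.
Hypothesis cV2 : C31 L V2.
Hypothesis lV1 : forall x, Iop L x -> `|dw (Icl L) V1 x| <= lam.
Hypothesis lV2 : forall x, Iop L x -> `|dw (Icl L) V2 x| <= lam.
Hypothesis lam0 : 0 <= lam.
Hypothesis sr1 : smooth_in_box L T r1 r1x r1xx r1t.
Hypothesis sr2 : smooth_in_box L T r2 r2x r2xx r2t.

Let s t x := r1 t x + r2 t x.
Let sx t x := r1x t x + r2x t x.
Let st t x := r1t t x + r2t t x.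

Hypothesis s_gt0 : forall t x, Icl T t -> Icl L x -> 0 < s t x.
Hypothesis r10 : forall x, Icl L x -> 0 <= r1 0 x.
Hypothesis r20 : forall x, Icl L x -> 0 <= r2 0 x.
Hypothesis pde1 : forall t x, Iop T t -> Iop L x -> r1t t x = Aop L eta f V1 (r1 t) (s t) x.
Hypothesis pde2 : forall t x, Iop T t -> Iop L x -> r2t t x = Aop L eta f V2 (r2 t) (s t) x.
Hypothesis bc10 : forall t, Iop T t -> flux L eta f V1 (r1 t) (s t) 0 = 0.
Hypothesis bc1L : forall t, Iop T t -> flux L eta f V1 (r1 t) (s t) L = 0.
Hypothesis bc20 : forall t, Iop T t -> flux L eta f V2 (r2 t) (s t) 0 = 0.
Hypothesis bc2L : forall t, Iop T t -> flux L eta f V2 (r2 t) (s t) L = 0.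

Let a := (alpha * kappa)^-1.
(** The constant of [dissipation_pointwise] times [theta * (theta + 1)], the coefficient in the
    second derivative of the power [- theta]. *)
Definition gronwall_rate := theta * (theta + 1) * (lam ^+ 2 / (2 * a)).
(** The same coefficient times the surviving [a / 2], divided by the square of the factor that the
    chain rule produces in [dissipation_density]. *)
Definition dissipation_rate :=
  theta * (theta + 1) * (a / 2) / ((alpha - 1 - theta) / 2) ^+ 2.
(** The squared space derivative of [s] to the power [(alpha - 1 - theta) / 2], with the chain rule
    carried out. *)
Definition dissipation_density t x :=
  ((alpha - 1 - theta) / 2 * s t x `^ ((alpha - 1 - theta) / 2 - 1) * sx t x) ^+ 2.

Let a_gt0 : 0 < a.
Proof. by rewrite invr_gt0 mulr_gt0//; case/andP: alpha01. Qed.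

Let theta0 : 0 < theta.
Proof. by case/andP: alpha01 => _ al1; rewrite (le_lt_trans _ alpha_theta)// subr_ge0. Qed.

Let gamma_gt0 : 0 < ((alpha - 1 - theta) / 2) ^+ 2.
Proof.
case/andP: alpha01 => _ al1; have ath := alpha_theta.
have h0 : (alpha - 1 - theta) / 2 < 0 by lra.
by rewrite exprn_even_gt0//= lt_eqF.
Qed.

Lemma dissipation_rate_gt0 : 0 < dissipation_rate.
Proof. by rewrite /dissipation_rate divr_gt0// !mulr_gt0// ?addr_gt0// divr_gt0. Qed.

Lemma gronwall_rate_ge0 : 0 <= gronwall_rate.
Proof.
have th1 : 0 <= theta + 1 by rewrite addr_ge0// ltW.
apply: mulr_ge0; first by rewrite mulr_ge0// ltW.
by rewrite divr_ge0 ?sqr_ge0// mulr_ge0// ltW.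
Qed.

Let ss : smooth_in_box L T s sx (fun t x => r1xx t x + r2xx t x) st := smoothD sr1 sr2.

Lemma has_dw_dissipation t x : Icl T t -> Icl L x ->
  has_dw (Icl L) (fun y => s t y `^ ((alpha - 1 - theta) / 2)) x
   ((alpha - 1 - theta) / 2 * s t x `^ ((alpha - 1 - theta) / 2 - 1) * sx t x).
Proof.
move=> It Ix.
exact: (has_dw_comp (is_derive_powR _ (s_gt0 It Ix)) (smooth_dx ss It Ix)).
Qed.

Lemma dissipation_density_continuous :
  {within box L T, continuous (fun p => dissipation_density p.1 p.2)}.
Proof.
have c1 : {within box L T, continuous (fun p => (alpha - 1 - theta) / 2 *
    s p.1 p.2 `^ ((alpha - 1 - theta) / 2 - 1) * sx p.1 p.2)}.
  apply: within_mul; last exact: (smooth_cont_x ss).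
  apply: within_scale.
  apply: (@within_comp _ _ _ (fun p : R * R => s p.1 p.2)
    (fun y => y `^ ((alpha - 1 - theta) / 2 - 1))); first exact: (smooth_cont ss).
  move=> [t x] [It Ix]; exact: is_derive_continuous (is_derive_powR _ (s_gt0 It Ix)).
exact: (within_mul c1 c1).
Qed.

Definition energy t := Rintegral Leb (Icl L) (fun x => s t x `^ (- theta)).
Definition dissipation t := Rintegral Leb (Icl L) (dissipation_density t).

Lemma energy_dissipation t : Icl T t ->
  energy t + dissipation_rate * Rintegral Leb (Icl t) dissipation + L <=
  (energy 0 + L) * expR (gronwall_rate * t).
Proof.
move=> It.
have r1_ge0 := solution_ge0 L0 T0 eta0 cf cV1 sr1 ss s_gt0 r10 pde1 bc10 bc1L.
have r2_ge0 := solution_ge0 L0 T0 eta0 cf cV2 sr2 ss s_gt0 r20 pde2 bc20 bc2L.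
pose Phi (y : R) := y `^ (- theta).
pose Phi1 (y : R) := - theta * y `^ (- theta - 1).
pose Phi2 (y : R) := theta * (theta + 1) * y `^ (- theta - 2).
(* The total density obeys a conservation law with the summed flux: the viscous parts add up to
   [eta * sx], and the common factor [fd 2 f (s) * sx] gets the weight [r1 + r2 = s]. *)
pose F t x := flux L eta f V1 (r1 t) (s t) x + flux L eta f V2 (r2 t) (s t) x.
pose P := [set y : R | 0 < y].
have uP t' x' : Icl T t' -> Icl L x' -> P (s t' x') by exact: s_gt0.
have dPhi (y : R) : P y -> is_derive y 1 Phi (Phi1 y) by exact: is_derive_powR.
have dPhi1 (y : R) : P y -> is_derive y 1 Phi1 (Phi2 y).
  move=> y0; have d := is_deriveZ (- theta) (is_derive_powR (- theta - 1) y0).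
  have -> : Phi2 y = - theta *: ((- theta - 1) * y `^ (- theta - 1 - 1)); last exact: d.
  have -> : - theta - 1 - 1 = - theta - 2 by ring.
  by rewrite /GRing.scale /= /Phi2; ring.
have cPhi2 (y : R) : P y -> {for y, continuous Phi2}.
  move=> y0; apply: (@continuous_comp _ _ _ (fun z => z `^ (- theta - 2))
    (fun z => theta * (theta + 1) * z)); last exact: mulrl_continuous.
  exact: is_derive_continuous (is_derive_powR _ y0).
have du (t' x' : R) : Iop T t' -> Iop L x' -> is_derive x' 1 (s t') (sx t' x').
  move=> It' Ix'; apply: (has_dw_is_derive (Icl_nbhs Ix')).
  exact: (smooth_dx ss (Iop_Icl It') (Iop_Icl Ix')).
have cF t' : Iop T t' -> {within Icl L, continuous (F t')}.
  move=> /Iop_Icl It'; apply: within_add.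
    exact: (flux_continuous L0 cf cV1 sr1 ss s_gt0).
  exact: (flux_continuous L0 cf cV2 sr2 ss s_gt0).
have dF (t' x' : R) : Iop T t' -> Iop L x' -> is_derive x' 1 (F t') (st t' x').
  move=> It' Ix'; rewrite /st pde1// pde2//; have It'' := Iop_Icl It'.
  have d1 := is_derive_flux L0 eta cf cV1 sr1 ss s_gt0 It'' Ix'.
  have d2 := is_derive_flux L0 eta cf cV2 sr2 ss s_gt0 It'' Ix'.
  exact: (is_deriveD d1 d2).
have F0 t' : Iop T t' -> F t' 0 = 0 by move=> It'; rewrite /F bc10// bc20// addr0.
have FL t' : Iop T t' -> F t' L = 0 by move=> It'; rewrite /F bc1L// bc2L// addr0.
have cE : {within Icl T, continuous energy}.
  exact: (energy_continuous T0 (smooth_cont ss) uP dPhi).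
have cI := energy_integrand_continuous (smooth_cont ss) (smooth_cont_x ss) uP cPhi2 cF.
have dE := energy_identity L0 (smooth_cont ss) (smooth_cont_x ss) (smooth_cont_t ss)
  uP du (smooth_dt ss) dPhi dPhi1 cPhi2 cF dF F0 FL.
have cP t' : Icl T t' -> {within Icl L, continuous (fun x => Phi (s t' x))}.
  move=> It'; apply: (within_comp (box_slice_x (smooth_cont ss) It')) => y Iy.
  exact: is_derive_continuous (dPhi _ (s_gt0 It' Iy)).
have cD : {within Icl T, continuous dissipation}.
  exact: (continuous_Rintegral_box T0 dissipation_density_continuous).
have cd t' : Icl T t' -> {within Icl L, continuous (dissipation_density t')}.
  exact: (box_slice_x dissipation_density_continuous).
pose E' t' := - Rintegral Leb (Icl L) (fun x => Phi2 (s t' x) * sx t' x * F t' x).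
have ineq t' : Iop T t' ->
    E' t' <= - dissipation_rate * dissipation t' + gronwall_rate * (L + energy t').
  move=> It'; have It'' := Iop_Icl It'.
  have mI := measurable_Icl L.
  have iL := Rintegral_Icl1 L0.
  have cc1 := within_scale (c := - dissipation_rate) (cd _ It'').
  have cc2 : {within Icl L, continuous (fun x => gronwall_rate * (1 + Phi (s t' x)))}.
    by apply: within_scale; apply: within_add; [exact: within_cst|exact: cP].
  have cc3 := within_scale (c := -1) (cI _ It').
  have -> : - dissipation_rate * dissipation t' + gronwall_rate * (L + energy t') =
      Rintegral Leb (Icl L) (fun x => - dissipation_rate * dissipation_density t' x +
         gronwall_rate * (1 + Phi (s t' x))).
    rewrite (RintegralD mI (Icl_integrable cc1) (Icl_integrable cc2)).
    rewrite (RintegralZl _ mI (Icl_integrable (cd _ It''))).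
    have i1 := Icl_integrable (@within_cst R R (Icl L) 1).
    have i2 := Icl_integrable (cP _ It'').
    have i3 := Icl_integrable (within_add (@within_cst R R (Icl L) 1) (cP _ It'')).
    by rewrite (RintegralZl _ mI i3) (RintegralD mI i1 i2) iL.
  (* The integrals move to the open interval, where nonnegativity of the densities and the bounds on
     the derivatives of the potentials are available. *)
  have -> : E' t' = Rintegral Leb (Iop L) (fun x => -1 * (Phi2 (s t' x) * sx t' x * F t' x)).
    rewrite (Rintegral_Iop cc3) (RintegralZl _ mI (Icl_integrable (cI _ It'))).
    by rewrite mulN1r.
  have cc12 := within_add cc1 cc2.
  rewrite -(Rintegral_Iop cc12).
  have mO : measurable (Iop L : set (measurableTypeR R)) by rewrite IopE.
  have sO : Iop L `<=` Icl L by exact: Iop_Icl.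
  apply: (le_Rintegral mO).
  - exact: (integrableS mI mO sO (Icl_integrable cc3)).
  - exact: (integrableS mI mO sO (Icl_integrable cc12)).
  move=> x Ix; have Ix' := Iop_Icl Ix.
  have s0 := s_gt0 It'' Ix'.
  have al1 : alpha <= 1 by case/andP: alpha01.
  pose G := r1 t' x * dw (Icl L) V1 x + r2 t' x * dw (Icl L) V2 x.
  (* Nonnegativity of both densities is used here: the absolute values add up to [s] itself. *)
  have HG : `|G| <= lam * s t' x.
    rewrite (le_trans (ler_normD _ _))// !normrM /s mulrDr.
    rewrite (ger0_norm (r1_ge0 _ _ It'' Ix)) (ger0_norm (r2_ge0 _ _ It'' Ix)).
    by rewrite lerD// mulrC ler_wpM2r// ?r1_ge0 ?r2_ge0 ?lV1 ?lV2.
  have := dissipation_pointwise (sx t' x) al1 theta0 alpha_theta (ltW eta0) a_gt0 s0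
    (fI2 s0) lam0 HG.
  have FE : F t' x = eta * sx t' x + s t' x * fd 2 f (s t' x) * sx t' x + G.
    rewrite /F (fluxE L0 eta cf cV1 sr1 ss s_gt0)// (fluxE L0 eta cf cV2 sr2 ss s_gt0)//.
    by rewrite /drift /G /s /sx; ring.
  rewrite -FE => H.
  have tt0 : 0 <= theta * (theta + 1) by rewrite mulr_ge0 ?addr_ge0// ltW.
  have := ler_wpM2l tt0 H.
  have -> : theta * (theta + 1) * - (s t' x `^ (- theta - 2) * sx t' x * F t' x) =
    -1 * (Phi2 (s t' x) * sx t' x * F t' x) by rewrite /Phi2; ring.
  move/le_trans; apply; rewrite le_eqVlt; apply/orP; left; apply/eqP.
  rewrite /dissipation_rate /dissipation_density /gronwall_rate /Phi.
  have -> : (alpha - 1 - theta) / 2 - 1 = (alpha - theta - 3) / 2 by lra.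
  have g0 : alpha - 1 - theta != 0.
    by rewrite lt_eqF//; have ath := alpha_theta; lra.
  by field; rewrite g0 gt_eqF.
pose W t' := Rintegral Leb (Icl t') dissipation.
have cW : {within Icl T, continuous W} by exact: continuous_Rintegral_sup.
have W_ge0 t' : Icl T t' -> 0 <= W t'.
  move=> It'; apply: Rintegral_ge0 => y Iy; apply: Rintegral_ge0 => x Ix.
  exact: sqr_ge0.
(* The summand [L] is the integral of 1; it absorbs the constant of [1 + Phi (s)], so that the
   differential inequality for [H] becomes homogeneous. *)
pose H t' := energy t' + dissipation_rate * W t' + L.
have cH : {within Icl T, continuous H}.
  by apply: within_add; [apply: within_add => //; exact: within_scale|exact: within_cst].
have dH t' : Iop T t' -> is_derive t' 1 H (E' t' + dissipation_rate * dissipation t').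
  move=> It'; have d1 : is_derive t' 1 energy (E' t') by exact: dE.
  have d2 := is_deriveZ dissipation_rate (is_derive_Rintegral_sup cD It').
  have := is_deriveD (is_deriveD d1 d2) (is_derive_cst L t' 1).
  by rewrite addr0.
(* Including [W] in [H] only enlarges the right-hand side, as [W] and both rates are nonnegative. *)
have hH t' : Iop T t' -> E' t' + dissipation_rate * dissipation t' <= gronwall_rate * H t'.
  move=> It'; have := ineq _ It'.
  have := mulr_ge0 gronwall_rate_ge0
    (mulr_ge0 (ltW dissipation_rate_gt0) (W_ge0 _ (Iop_Icl It'))).
  by rewrite /H !mulrDr; lra.
have := gronwall T0 cH dH hH It.
by rewrite /H /W Rintegral_Icl0 mulr0 addr0.
Qed.

End Estimate.

(** What the three cases share. The range of [alpha] is closed above because the logarithmic case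
    has [alpha = 1]. *)
Lemma hyp_f_range (R : realType) (L alpha kappa : R) f : hyp_f L alpha kappa f ->
  [/\ 0 < alpha <= 1, 0 < kappa & I2 alpha kappa f].
Proof.
case=> [[/andP[a0 a1] [k0 [_ [h2 _]]]]|[[-> [k0 [_ [h2 _]]]]|]].
- by split=> //; rewrite a0 ltW.
- by split=> //; rewrite ltr01 lexx.
- by move=> [/andP[a0 a1] [k0 [_ [_ [h2 _]]]]]; split=> //; rewrite a0 ltW.
Qed.

(** * Choice of the constant and assembly of the bound *)

Unset Implicit Arguments.

Theorem theorem4p2 (R : realType) (alpha kappa theta L T M Lip1 Lip2 : R) :
  0 < L -> 0 < T -> 1 - alpha < theta ->
  exists K : R, 0 < K /\
  forall (f : R -> R) (eta : R) (V1 V2 r10 r20 : R -> R) (r1 r2 : R -> R -> R),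
    hyp_f L alpha kappa f ->
    0 < eta <= 1 ->
    standing L eta f V1 V2 r10 r20 ->
    lip_on (Icl L) Lip1 V1 -> lip_on (Icl L) Lip2 V2 ->
    Rintegral Leb (Iop L) (fun x => (r10 x + r20 x) `^ (- theta)) = M ->
    classical_solution L T eta f V1 V2 r10 r20 r1 r2 ->
    let sig := fun t x => r1 t x + r2 t x in
    sup [set Rintegral Leb (Iop L) (fun x => sig t x `^ (- theta)) | t in Jcl T]
    + Num.sqrt (Rintegral Leb (Jcl T) (fun t =>
        Rintegral Leb (Iop L) (fun x =>
          (dw (Icl L) (fun y => sig t y `^ ((alpha - 1 - theta) / 2)) x) ^+ 2)))
    < K.
Proof.
move=> L0 T0 alth.
(* The constant is chosen before [f], so the range of [alpha] and [kappa] is decided first; outside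
   it no [f] satisfies [hyp_f] and any positive constant will do. *)
have [[al01 ka0]|nak] := pselect (0 < alpha <= 1 /\ 0 < kappa); last first.
  exists 1; split=> // f eta V1 V2 r10 r20 r1 r2 hf.
  by exfalso; apply: nak; have [] := hyp_f_range hf.
(* Absolute values here and around [M] below supply signs that are unknown before any solution is
   given. *)
pose lam := Num.max `|Lip1| `|Lip2|.
pose B := (`|M| + L) * expR (gronwall_rate alpha kappa theta lam * T).
pose c := dissipation_rate alpha kappa theta.
have c0 : 0 < c by exact: dissipation_rate_gt0.
have lam0 : 0 <= lam by rewrite le_max normr_ge0.
have rate0 := gronwall_rate_ge0 lam al01 ka0 alth.
have B0 : 0 < B by rewrite mulr_gt0 ?expR_gt0// ltr_wpDl.
(* [B] bounds the supremum, [Num.sqrt (B / c)] the gradient norm, and 1 makes the inequality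
   strict. *)
exists (B + Num.sqrt (B / c) + 1); split.
  by rewrite addr_gt0// ltr_wpDr// sqrtr_ge0.
move=> f eta V1 V2 r10 r20 r1 r2 hf /andP[eta0 _] std.
have [cV1 [cV2 [_ [_ [_ [_ [_ [_ [r0 std']]]]]]]]] := std.
have [_ [_ [_ [_ [_ [_ [_ [_ [_ [_ [_ [[beta [_ [cf _]]] _]]]]]]]]]]]] := std'.
move=> lV1 lV2 EM sol; cbv zeta; set sig := fun t x => r1 t x + r2 t x.
have [sr1 [sr2 [s_gt0 [init [pde bc]]]]] := sol.
have [_ _ fI2] := hyp_f_range hf.
have S1 := sol_regular_smooth L0 T0 sr1.
have S2 := sol_regular_smooth L0 T0 sr2.
have dV1 x : Iop L x -> `|dw (Icl L) V1 x| <= lam.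
  move=> Ix; rewrite (le_trans (dw_lip L0 cV1 lV1 Ix))//.
  by rewrite (le_trans (ler_norm _))// le_max lexx.
have dV2 x : Iop L x -> `|dw (Icl L) V2 x| <= lam.
  move=> Ix; rewrite (le_trans (dw_lip L0 cV2 lV2 Ix))//.
  by rewrite (le_trans (ler_norm _))// le_max lexx orbT.
have r1_0 x : Icl L x -> 0 <= r1 0 x.
  by move=> Ix; rewrite (init x Ix).1; have [] := r0 x Ix.
have r2_0 x : Icl L x -> 0 <= r2 0 x.
  by move=> Ix; rewrite (init x Ix).2; have [] := r0 x Ix.
have main := energy_dissipation L0 T0 eta0 al01 ka0 alth cf fI2 cV1 cV2 dV1 dV2 lam0
  S1 S2 s_gt0 r1_0 r2_0 (fun t x It Ix => (pde t x It Ix).1)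
  (fun t x It Ix => (pde t x It Ix).2) (fun t It => (bc t It).1)
  (fun t It => (bc t It).2.1) (fun t It => (bc t It).2.2.1)
  (fun t It => (bc t It).2.2.2).
have cP t : Icl T t -> {within Icl L, continuous (fun x => sig t x `^ (- theta))}.
  move=> It; have cs := box_slice_x (smooth_cont (smoothD S1 S2)) It.
  apply: (@within_comp R R (Icl L) (sig t) (fun y => y `^ (- theta)) cs).
  by move=> x Ix; exact: is_derive_continuous (is_derive_powR _ (s_gt0 t x It Ix)).
have I0 : Icl T 0 by rewrite IclP lexx ltW.
have IT : Icl T T by rewrite IclP lexx ltW.
have E0 : energy L theta r1 r2 0 = M.
  rewrite -EM /energy -(Rintegral_Iop (cP 0 I0)); apply: eq_Rintegral => x.
  by rewrite inE => /Iop_Icl Ix; rewrite /sig (init x Ix).1 (init x Ix).2.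
(* Both terms on the left are nonnegative, so [B] bounds each: the first is read off at every [t],
   the second at [t = T]. *)
have bound t : Icl T t -> energy L theta r1 r2 t + c * Rintegral Leb (Icl t)
    (dissipation L alpha theta r1 (fun t => dw (Icl L) (r1 t)) r2
       (fun t => dw (Icl L) (r2 t))) <= B.
  move=> It; have := main t It; rewrite E0.
  have -> : (M + L) * expR (gronwall_rate alpha kappa theta lam * t) =
    M * expR (gronwall_rate alpha kappa theta lam * t) +
    L * expR (gronwall_rate alpha kappa theta lam * t) by rewrite mulrDl.
  move=> H; rewrite -(lerD2r L); apply: (le_trans H).
  have /andP[t0 tT] := (IclP _ _).1 It.
  have le : expR (gronwall_rate alpha kappa theta lam * t) <=
      expR (gronwall_rate alpha kappa theta lam * T) by rewrite ler_expR ler_wpM2l.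
  rewrite -mulrDl (@le_trans _ _ B)//; last by rewrite lerDl ltW.
  apply: (@le_trans _ _ ((`|M| + L) * expR (gronwall_rate alpha kappa theta lam * t))).
    by rewrite ler_wpM2r ?expR_ge0// lerD2r ler_norm.
  by rewrite ler_wpM2l// addr_ge0// ltW.
have D_ge0 t : Icl T t -> 0 <= Rintegral Leb (Icl t)
    (dissipation L alpha theta r1 (fun t => dw (Icl L) (r1 t)) r2
       (fun t => dw (Icl L) (r2 t))).
  by move=> It; do 2! apply: Rintegral_ge0 => ? _; exact: sqr_ge0.
have e_ge0 t : 0 <= energy L theta r1 r2 t.
  by apply: Rintegral_ge0 => x _; exact: powR_ge0.
have supB : sup [set Rintegral Leb (Iop L) (fun x => sig t x `^ (- theta)) | t in Jcl T] <= B.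
  (* The time 0 witnesses that the set is nonempty. *)
  apply: ge_sup; first by exists (Rintegral Leb (Iop L) (fun x => sig 0 x `^ (- theta))); exists 0.
  move=> _ [t It <-]; rewrite (Rintegral_Iop (cP t It)).
  by apply: le_trans (bound t It); rewrite lerDl mulr_ge0 ?(ltW c0)// D_ge0.
have dissE : Rintegral Leb (Jcl T) (fun t => Rintegral Leb (Iop L) (fun x =>
          (dw (Icl L) (fun y => sig t y `^ ((alpha - 1 - theta) / 2)) x) ^+ 2)) =
   Rintegral Leb (Icl T) (dissipation L alpha theta r1 (fun t => dw (Icl L) (r1 t)) r2
       (fun t => dw (Icl L) (r2 t))).
  apply: eq_Rintegral => t; rewrite inE => It.
  have cd := box_slice_x (dissipation_density_continuous (alpha := alpha) (theta := theta)
    S1 S2 s_gt0) It.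
  rewrite /dissipation -(Rintegral_Iop cd); apply: eq_Rintegral => x.
  rewrite inE => /Iop_Icl Ix.
  by rewrite (Icl_dwE L0 Ix (has_dw_dissipation (alpha := alpha) (theta := theta)
    S1 S2 s_gt0 It Ix)).
rewrite dissE; set D := Rintegral _ _ _.
have DB : D <= B / c.
  rewrite ler_pdivlMr// mulrC; apply: le_trans (bound T IT).
  by rewrite lerDr.
apply: (@le_lt_trans _ _ (B + Num.sqrt (B / c))); last by rewrite ltrDl.
by rewrite lerD// ler_wsqrtr.
Qed.
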